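(* Let $(\mathcal X,d)$ be a metric space, $P$ a probability distribution on $\mathcal X\times\mathbb R$, $F\subset C(\mathcal X,\mathcal X)$, $H\subset C(\mathcal X)$, and for $k\ge 0$ let $\mathcal H_k:=H\circ B(k,F)$. Let $\ell:\mathbb R\times\mathbb R\to[0,b]$ be a measurable loss with $|\ell(a,y)-\ell(a',y)|\le\beta_\ell|a-a'|$ for all $a,a',y$. Let $\mathcal C$ be a nonempty class of measurable functions $\mathcal X\to\mathbb R$ (the concept class), $\mathcal H_{\rm imp}\subset L^\infty(\mathcal X)$ an implementation class, and $\Phi_{\rm embed}:\mathcal H_k\to\mathcal H_{\rm imp}$ a map. Fix $k\ge0$ and assume that $\mathcal H_k\subset L^\infty(\mathcal X)$ is separable. Let $\mathcal D=((X_1,Y_1),\dots,(X_n,Y_n))\sim P^n$, let $\hat f\in\mathcal H_k$ be a minimizer of the empirical risk $\hat L$ over $\mathcal H_k$, and let $\hat h:=\Phi_{\rm embed}(\hat f)$. Put $$\varepsilon_{\rm imp}(k):=\sup_{f\in\mathcal H_k}\|f-\Phi_{\rm embed}(f)\|_\infty,\qquad \varepsilon_{\rm model}(k):=\inf_{f\in\mathcal H_k}L[f]-\inf_{c\in\mathcal C}L[c].$$ Then there is a universal constant $C$ such that for every $\delta\in(0,1)$, with probability at least $1-\delta$ over $\mathcal D\sim P^n$, $$L[\hat h]-\inf_{c\in\mathcal C}L[c]\le \beta_\ell\,\varepsilon_{\rm imp}(k)+\varepsilon_{\rm model}(k)+4\beta_\ell\,\hat{\mathfrak R}_S(\mathcal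 H_k)+Cb\sqrt{\frac{\log(1/\delta)}{n}},$$ $$L[\hat h]-\hat L[\hat h]\le 2\beta_\ell\,\varepsilon_{\rm imp}(k)+2\beta_\ell\,\hat{\mathfrak R}_S(\mathcal H_k)+Cb\sqrt{\frac{\log(1/\delta)}{n}}.$$ The same bounds hold with $\hat{\mathfrak R}_S(\mathcal H_k)$ replaced by $\mathfrak R_n(\mathcal H_k)$.
   Context: $C(\mathcal X,\mathcal X)$ is the set of continuous self-maps of $\mathcal X$, $C(\mathcal X)$ the set of continuous real functions. $B(k,F)$ is the set of all compositions $f_m\circ\cdots\circ f_1$ with $0\le m\le k$ and $f_i\in F$ (including the identity when $m=0$), and $H\circ B(k,F)=\{h\circ f: h\in H, f\in B(k,F)\}$. $L^\infty(\mathcal X)$ denotes bounded measurable real functions with the supremum norm $\|\cdot\|_\infty$. Risks: $L[f]:=\mathbb E[\ell(f(X),Y)]$ for $(X,Y)\sim P$, and $\hat L[f]:=\frac1n\sum_{i=1}^n\ell(f(X_i),Y_i)$. $S=(X_1,\dots,X_n)$ is the input part of the sample. For a class $G$ of real functions, $\hat{\mathfrak R}_S(G):=\mathbb E_\sigma\big[\sup_{g\in G}\frac1n\sum_{i=1}^n\sigma_i g(X_i)\big]$ with $\sigma_i$ i.i.d. Rademacher signs, and $\mathfrak R_n(G):=\mathbb E_{S\sim P_X^n}\hat{\mathfrak R}_S(G)$, where $P_X$ is the $\mathcal X$-marginal of $P$.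
   Formalization: Each bound is proved with probability at least 1-δ for every δ in (0,1), but both on one event only for δ ≤ 1/2: for δ near 1 the simultaneous claim fails for every universal C. *)

(* Defs.v *)
From HB Require Import structures.
From mathcomp Require Import all_boot all_order all_algebra.
From mathcomp Require Import all_classical all_reals all_analysis.
Import Order.TTheory GRing.Theory Num.Theory.
Import numFieldNormedType.Exports.

Set Implicit Arguments.
Unset Strict Implicit.
Unset Printing Implicit Defensive.

Local Open Scope classical_set_scope.
Local Open Scope ring_scope.

(* Measurable spaces are pointed in the library; a metric space carrying a
   probability distribution is nonempty, so this is no restriction. *)
#[short(type="pmetricType")]
HB.structure Definition PointedMetric (K : numDomainType) :=
  { T of Pointed T & Metric K T }.

Notation borel T := (g_sigma_algebraType (@open T)).

Section power_probability.
Context {d : measure_display} {T : measurableType d} {R : realType}.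

Definition consT (n : nat) (z : T * n.-tuple T) : n.+1.-tuple T :=
  [tuple of z.1 :: z.2].

Lemma measurable_consT n : measurable_fun setT (@consT n).
Proof. exact: measurable_cons. Qed.

HB.instance Definition _ n :=
  @isMeasurableFun.Build _ _ _ _ (@consT n) (@measurable_consT n).

Fixpoint power (P : probability T R) (n : nat) : probability (n.-tuple T) R :=
  match n with
  | 0%N => \d_([tuple] : 0.-tuple T)
  | m.+1 => distribution (P \x power P m)%E (@consT m)
  end.

Lemma power_rect (P : probability T R) (n : nat) (A : 'I_n -> set T) :
  (forall i, measurable (A i)) ->
  power P n [set t | forall i, A i (tnth t i)] = (\prod_(i < n) P (A i))%E.
Proof.
elim: n A => [|n IH] A mA /=.
  by rewrite big_ord0 diracE mem_set// => -[].
have mrect m (B : 'I_m -> set T) : (forall i, measurable (B i)) ->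
    measurable [set t : m.-tuple T | forall i, B i (tnth t i)].
  move=> mB; rewrite (_ : [set t | _] =
      \bigcap_(i in [set: 'I_m]) ((@tnth m T ^~ i) @^-1` (B i))).
    apply: fin_bigcap_measurable => // i _.
    rewrite -[X in measurable X]setTI.
    by have /(_ measurableT _ (mB i)) := @measurable_tnth _ T m i.
  by apply/seteqP; split=> t /= Bt i; [move=> _|]; exact: Bt.
rewrite /distribution /pushforward.
rewrite (_ : _ @^-1` _ = A ord0 `*`
    [set t : n.-tuple T | forall i, A (lift ord0 i) (tnth t i)]).
  rewrite product_measure1E//; last by apply: (mrect n (fun i => A (lift ord0 i))) => i.
  by rewrite big_ord_recl -IH.
apply/seteqP; split=> [[x t] /= At|[x t] /= [Ax At] i].
  split; first by have := At ord0.
  by move=> i; have := At (lift ord0 i); rewrite tnthS.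
case: (unliftP ord0 i) => [j ->|->//]; by rewrite tnthS.
Qed.

End power_probability.

HB.instance Definition _ {d1 d2} {T1 : measurableType d1}
    {T2 : measurableType d2} :=
  @isMeasurableFun.Build _ _ (T1 * T2)%type T1 fst measurable_fst.

Section composition_classes.
Context {T U : Type}.

(* [compn f m] is [f (m-1) \o ... \o f 0] *)
Fixpoint compn (f : nat -> T -> T) (m : nat) : T -> T :=
  if m is m'.+1 then f m' \o compn f m' else idfun.

Definition compositions (k : nat) (F : set (T -> T)) : set (T -> T) :=
  [set g | exists m : nat, exists f : nat -> T -> T,
    [/\ (m <= k)%N, forall i, (i < m)%N -> F (f i) & g = compn f m]].

Definition comp_class (H : set (T -> U)) (F : set (T -> T)) (k : nat) :
    set (T -> U) :=
  [set h \o f | h in H & f in compositions k F].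

End composition_classes.

Section supremum_norm.
Context {R : realType} {X : pmetricType R}.
Implicit Types (f g : X -> R) (G : set (X -> R)).

(* Genuine suprema over all points, not essential suprema. *)
Definition sup_norm f : \bar R := ereal_sup [set `|f x|%:E | x in [set: X]].

Definition Linfty : set (X -> R) :=
  [set f | measurable_fun setT (f : borel X -> R) /\ bounded_fun f].

Definition sup_separable G : Prop :=
  exists A : set (X -> R), [/\ countable A, A `<=` G &
    forall f, G f -> forall e : R, 0 < e ->
      exists2 g, A g & (sup_norm (f \- g)%R < e%:E)%E].

Definition eps_imp G (Phi : (X -> R) -> X -> R) : \bar R :=
  ereal_sup [set sup_norm (f \- Phi f)%R | f in G].

End supremum_norm.

Section risks.
Context {R : realType} {X : pmetricType R}.
Variable P : probability (borel X * R)%type R.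
Variable l : R -> R -> R.
Implicit Types (f : X -> R) (G C : set (X -> R)).
Local Open Scope ereal_scope.

Definition risk f : \bar R := 'E_P[fun z => l (f z.1) z.2].

Definition emp_risk (n : nat) (D : n.-tuple (borel X * R)%type) f : \bar R :=
  (n%:R^-1 * \sum_(i < n) l (f (tnth D i).1) (tnth D i).2)%R%:E.

Definition inf_risk G : \bar R := ereal_inf [set risk f | f in G].

Definition eps_model G C : \bar R := inf_risk G - inf_risk C.

Definition is_erm (n : nat) (D : n.-tuple (borel X * R)%type) G f : Prop :=
  G f /\ forall g, G g -> emp_risk D f <= emp_risk D g.

End risks.

Section rademacher.
Context {R : realType} {X : pmetricType R}.
Local Open Scope ereal_scope.

(* The Rademacher signs are [(-1) ^+ s i], with [s] uniform. *)
Definition emp_rademacher (n : nat) (S : n.-tuple (borel X))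
    (G : set (X -> R)) : \bar R :=
  (2 ^- n)%R%:E * \sum_(s : {ffun 'I_n -> bool})
    ereal_sup [set (n%:R^-1 * \sum_(i < n) (-1) ^+ s i * g (tnth S i))%R%:E
              | g in G].

Definition rademacher (n : nat) (PX : probability (borel X) R)
    (G : set (X -> R)) : \bar R :=
  \int[power PX n]_S emp_rademacher S G.

Definition marginal (P : probability (borel X * R)%type R) :
    probability (borel X) R :=
  distribution P fst.

Definition inputs (n : nat) (D : n.-tuple (borel X * R)%type) :
    n.-tuple (borel X) :=
  [tuple of map fst D].

End rademacher.

(* [E] itself need not be measurable (a minimizer of the empirical risk need not
   be chosen measurably), so the mass is that of a measurable subset. *)
Definition holds_with_probability {d : measure_display} {T : measurableType d}
    {R : realType} (Q : probability T R) (p : R) (E : set T) : Prop :=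
  exists A : set T, [/\ measurable A, A `<=` E & (p%:E <= Q A)%E].

(* Main.v *)
Require Import Defs.
From HB Require Import structures.
From mathcomp Require Import all_boot all_order all_algebra.
From mathcomp Require Import all_classical all_reals all_analysis.
From mathcomp Require Import measurable_realfun ring lra.
Import Order.TTheory GRing.Theory Num.Theory.
Import numFieldNormedType.Exports.
Local Open Scope classical_set_scope.
Local Open Scope ring_scope.

(* Let U = sup (L - Lhat) and V = sup (Lhat - L) over the class, and let W be the
   Rademacher average of the losses, either on the sample or in the mean.
   Symmetrization gives E U <= 2 E W and E V <= 2 E W.  The functions U - 2W and
   U + V - 4W have bounded differences of order b/n even when the hypotheses
   are not uniformly bounded, so McDiarmid's inequality bounds them with
   probability 1 - delta without a union bound.  Only then is W bounded,
   pointwise in the sample, by beta times the Rademacher complexity of the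
   hypothesis class (contraction).  The bounds follow from Lipschitz continuity
   of the loss and, for the excess risk, from the minimality of the empirical
   risk.  Suprema are taken over a dense sequence, hence are measurable. *)

(** A union bound would turn log(1/delta) into log(2/delta), which no constant multiple of
    log(1/delta) dominates as delta tends to 1, and every delta in (0,1) is covered. Each bound
    therefore has to come from a single concentration event. The joint statement can afford two
    events because, for delta at most 1/2, running each at level delta^2 costs 2 delta^2 <= delta
    and only doubles the logarithm. W is built from losses because these lie in [0,b], so that one
    observation moves an average by at most b/n; the complexity of the hypothesis class has no such
    control and may even be infinite, its members being bounded only one by one. V enters as a
    supremum over the whole class because the infimum of the risk need not be attained: all
    competitors of the empirical minimizer are controlled at once. *)

Set Implicit Arguments.
Unset Strict Implicit.
Unset Printing Implicit Defensive.

(** * Bounded measurable functions *)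

Section sup_sequence.
Context {R : realType}.
Implicit Types (u v : nat -> R).

Lemma eq_sup_range u v : u =1 v -> sup (range u) = sup (range v).
Proof. by move=> /funext ->. Qed.

(** The bound [M] matters: [sup] of a set without upper bound is 0 by convention. *)
Lemma sup_range_ub u M j : (forall i, u i <= M) -> u j <= sup (range u).
Proof.
move=> uM; apply: ub_le_sup; last by exists j.
by exists M => _ [i _ <-].
Qed.

Lemma sup_range_le u x : (forall i, u i <= x) -> sup (range u) <= x.
Proof.
by move=> ux; apply: ge_sup => [|_ [i _ <-]//]; exists (u 0%N), 0%N.
Qed.

Lemma sup_range_norm u M : (forall i, `|u i| <= M) -> `|sup (range u)| <= M.
Proof.
move=> uM; have uM' i : u i <= M by exact: le_trans (ler_norm _) (uM i).
rewrite ler_norml sup_range_le// andbT.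
apply: le_trans _ (sup_range_ub 0%N uM').
by have := uM 0%N; rewrite ler_norml => /andP[].
Qed.

Lemma sup_range_dist u v M c : (forall i, u i <= M) -> (forall i, v i <= M) ->
  (forall i, `|u i - v i| <= c) -> `|sup (range u) - sup (range v)| <= c.
Proof.
move=> uM vM uvc; rewrite ler_distl; apply/andP; split.
  rewrite lerBlDr; apply: sup_range_le => i.
  have := sup_range_ub i uM; have := uvc i.
  by rewrite ler_norml => /andP[]; lra.
apply: sup_range_le => i; have := sup_range_ub i vM; have := uvc i.
by rewrite ler_norml => /andP[]; lra.
Qed.

End sup_sequence.

Section bounded_measurable.
Context {d : measure_display} {T : measurableType d} {R : realType}.
Implicit Types (f g : T -> R) (P : probability T R).

(** Such functions are integrable for every probability and stable under all the operations below,
    so integrals can be computed in [R] and Fubini's theorem applies without further conditions. *)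
Definition bmeasurable f :=
  measurable_fun setT f /\ exists M, forall x, `|f x| <= M.

Lemma bmeasurable_integrable P f :
  bmeasurable f -> P.-integrable setT (EFin \o f).
Proof.
move=> [mf [M fM]]; apply: measurable_bounded_integrable => //.
  by rewrite [X in (X < _)%E]probability_setT ltry.
exists M; split; first exact: num_real.
by move=> y My x _; exact: le_trans (fM x) (ltW My).
Qed.

Lemma bmeasurable_cst (c : R) : bmeasurable (fun=> c).
Proof. by split; [exact: measurable_cst|exists `|c|]. Qed.

Lemma bmeasurableD f g :
  bmeasurable f -> bmeasurable g -> bmeasurable (fun x => f x + g x).
Proof.
move=> [mf [M fM]] [mg [N gN]]; split; first exact: measurable_funD.
by exists (M + N) => x; rewrite (le_trans (ler_normD _ _))// lerD.
Qed.

Lemma bmeasurableZ c f : bmeasurable f -> bmeasurable (fun x => c * f x).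
Proof.
move=> [mf [M fM]]; split.
  by apply: measurable_funM => //; exact: measurable_cst.
by exists (`|c| * M) => x; rewrite normrM ler_wpM2l.
Qed.

Lemma bmeasurableN f : bmeasurable f -> bmeasurable (fun x => - f x).
Proof.
by move=> /(bmeasurableZ (-1)); congr bmeasurable; apply/funext => x; rewrite mulN1r.
Qed.

Lemma bmeasurableB f g :
  bmeasurable f -> bmeasurable g -> bmeasurable (fun x => f x - g x).
Proof. by move=> bf bg; apply: bmeasurableD => //; exact: bmeasurableN. Qed.

Lemma bmeasurable_sum (I : Type) (s : seq I) (f : I -> T -> R) :
  (forall i, bmeasurable (f i)) -> bmeasurable (fun x => \sum_(i <- s) f i x).
Proof.
move=> bf; elim: s => [|i s IH].
  by under eq_fun do rewrite big_nil; exact: bmeasurable_cst.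
by under eq_fun do rewrite big_cons; exact: bmeasurableD.
Qed.

Lemma bmeasurable_expR f : bmeasurable f -> bmeasurable (fun x => expR (f x)).
Proof.
move=> [mf [M fM]]; split; first exact: measurableT_comp.
exists (expR M) => x; rewrite ger0_norm ?expR_ge0// ler_expR.
exact: le_trans (ler_norm _) (fM x).
Qed.

Lemma bmeasurable_sup (v : nat -> T -> R) M :
  (forall j, measurable_fun setT (v j)) -> (forall j x, `|v j x| <= M) ->
  bmeasurable (fun x => sup (range (v ^~ x))).
Proof.
move=> mv vM; split; last by exists M => x; exact: sup_range_norm.
(* The supremum of a sequence is the term of index 0 of its sequence of tail suprema, whose
   measurability is known. *)
have -> : (fun x => sup (range (v ^~ x))) = (fun x => sups (v ^~ x) 0%N).
  apply/funext => x; rewrite /sups /= /sdrop; congr sup.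
  by apply/seteqP; split => _ [i _ <-]; exists i.
apply: measurable_fun_sups => // x _; exists M => _ [i _ <-].
exact: le_trans (ler_norm _) (vM i x).
Qed.

Lemma RintegralD_bm P f g : bmeasurable f -> bmeasurable g ->
  \int[P]_x (f x + g x) = \int[P]_x f x + \int[P]_x g x.
Proof. by move=> bf bg; rewrite RintegralD//; exact: bmeasurable_integrable. Qed.

Lemma RintegralZ_bm P c f : bmeasurable f ->
  \int[P]_x (c * f x) = c * \int[P]_x f x.
Proof. by move=> bf; rewrite RintegralZl//; exact: bmeasurable_integrable. Qed.

Lemma RintegralN_bm P f : bmeasurable f -> \int[P]_x (- f x) = - \int[P]_x f x.
Proof.
move=> bf; under eq_Rintegral do rewrite -mulN1r.
by rewrite RintegralZ_bm// mulN1r.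
Qed.

Lemma RintegralB_bm P f g : bmeasurable f -> bmeasurable g ->
  \int[P]_x (f x - g x) = \int[P]_x f x - \int[P]_x g x.
Proof. by move=> bf bg; rewrite RintegralB//; exact: bmeasurable_integrable. Qed.

Lemma Rintegral_cst_prob P (c : R) : \int[P]_x c = c.
Proof. by rewrite Rintegral_cst// [X in fine X]probability_setT/= mulr1. Qed.

Lemma le_Rintegral_bm P f g : bmeasurable f -> bmeasurable g ->
  (forall x, f x <= g x) -> \int[P]_x f x <= \int[P]_x g x.
Proof.
by move=> bf bg fg; apply: le_Rintegral => //; exact: bmeasurable_integrable.
Qed.

Lemma Rintegral_le_cst P f c : bmeasurable f -> (forall x, f x <= c) ->
  \int[P]_x f x <= c.
Proof.
move=> bf fc; rewrite -[leRHS](Rintegral_cst_prob P).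
by apply: le_Rintegral_bm => //; exact: bmeasurable_cst.
Qed.

Lemma Rintegral_norm_le P f c : bmeasurable f -> (forall x, `|f x| <= c) ->
  `|\int[P]_x f x| <= c.
Proof.
move=> bf fc; apply/ler_normlP; split; last first.
  by apply: Rintegral_le_cst => // x; exact: le_trans (ler_norm _) (fc x).
rewrite -RintegralN_bm//; apply: Rintegral_le_cst => [|x].
  exact: bmeasurableN.
by rewrite (le_trans (ler_norm _))// normrN.
Qed.

Lemma EFin_Rintegral P f : bmeasurable f ->
  (\int[P]_x f x)%:E = (\int[P]_x (f x)%:E)%E.
Proof.
by move=> bf; rewrite fineK// integrable_fin_num//; exact: bmeasurable_integrable.
Qed.

End bounded_measurable.

Lemma bmeasurable_comp {d1 d2 : measure_display} {T1 : measurableType d1}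
    {T2 : measurableType d2} {R : realType} (f : T2 -> R) (g : T1 -> T2) :
  measurable_fun setT g -> bmeasurable f -> bmeasurable (fun x => f (g x)).
Proof.
move=> mg [mf [M fM]]; split; first exact: measurableT_comp.
by exists M => x.
Qed.

(** * Fubini's theorem for bounded functions *)

Section fubini_bounded.
Context {d1 d2 : measure_display} {T1 : measurableType d1}
  {T2 : measurableType d2} {R : realType}.
Variables (P1 : probability T1 R) (P2 : probability T2 R) (f : T1 * T2 -> R).
Hypothesis bf : bmeasurable f.

Lemma bmeasurable_pair1 x : bmeasurable (fun y => f (x, y)).
Proof. by apply: bmeasurable_comp bf; exact: measurable_pair1. Qed.

Lemma bmeasurable_pair2 y : bmeasurable (fun x => f (x, y)).
Proof. by apply: bmeasurable_comp bf; exact: measurable_pair2. Qed.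

Lemma bmeasurable_Rintegral : bmeasurable (fun x => \int[P2]_y f (x, y)).
Proof.
split.
  apply/measurable_EFinP.
  have -> : EFin \o (fun x => \int[P2]_y f (x, y)) =
            fun x => (\int[P2]_y (f (x, y))%:E)%E.
    by apply/funext => x /=; rewrite EFin_Rintegral//; exact: bmeasurable_pair1.
  apply: (@measurable_fubini_F _ _ _ _ _ P1 P2 (EFin \o f)).
  exact: (bmeasurable_integrable (P1 \x P2)%E).
case: bf => _ [M fM]; exists M => x.
by apply: Rintegral_norm_le => //; exact: bmeasurable_pair1.
Qed.

Lemma Rintegral_prod :
  \int[(P1 \x P2)%E]_z f z = \int[P1]_x \int[P2]_y f (x, y).
Proof.
apply: EFin_inj; rewrite !EFin_Rintegral//; last exact: bmeasurable_Rintegral.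
rewrite -(@integral12_prod_meas1 _ _ _ _ _ P1 P2 (EFin \o f)); last first.
  exact: (bmeasurable_integrable (P1 \x P2)%E).
apply: eq_integral => x _ /=; rewrite EFin_Rintegral//.
exact: bmeasurable_pair1.
Qed.

End fubini_bounded.

Lemma Rintegral_swap {d1 d2 : measure_display} {T1 : measurableType d1}
    {T2 : measurableType d2} {R : realType}
    (P1 : probability T1 R) (P2 : probability T2 R) (f : T1 * T2 -> R) :
  bmeasurable f ->
  \int[P1]_x \int[P2]_y f (x, y) = \int[P2]_y \int[P1]_x f (x, y).
Proof.
move=> bf.
have bf' : bmeasurable (fun z => f (z.2, z.1)).
  by apply: bmeasurable_comp bf; exact: measurable_fun_pair.
apply: EFin_inj; rewrite !EFin_Rintegral//; last 2 first.
- exact: (bmeasurable_Rintegral P2 P1 bf').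
- exact: (bmeasurable_Rintegral P1 P2).
under eq_integral do rewrite (EFin_Rintegral _ (bmeasurable_pair1 bf _)).
under [RHS]eq_integral do rewrite (EFin_Rintegral _ (bmeasurable_pair2 bf _)).
apply: (@Fubini _ _ _ _ _ P1 P2 (EFin \o f)).
exact: (bmeasurable_integrable (P1 \x P2)%E).
Qed.

(** * Integration over a power of a probability, one coordinate at a time *)

Section power_integral.
Context {d : measure_display} {T : measurableType d} {R : realType}.
Variable P : probability T R.

(** The nonnegative extended version is for the empirical Rademacher complexity, which may be
    infinite; the bounded version that follows is for everything else. *)
Lemma integral_power_cons n (f : n.+1.-tuple T -> \bar R) :
  measurable_fun setT f -> (forall t, 0 <= f t)%E ->
  (\int[power P n.+1]_t f t =
   \int[P]_x \int[power P n]_t f (consT (x, t)))%E.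
Proof.
move=> mf f0; rewrite /= ge0_integral_distribution//.
rewrite fubini_tonelli1//; last by move=> x; exact: f0.
by apply: measurableT_comp => //; exact: measurable_consT.
Qed.

Lemma Rintegral_power_cons n (f : n.+1.-tuple T -> R) : bmeasurable f ->
  \int[power P n.+1]_t f t = \int[P]_x \int[power P n]_t f (consT (x, t)).
Proof.
move=> bf; have bg := bmeasurable_comp (@measurable_consT _ T n) bf.
rewrite -(Rintegral_prod P (power P n) bg)//.
congr fine; rewrite /= integral_distribution//.
- by apply/measurable_EFinP; case: bf.
- exact: (bmeasurable_integrable (P \x power P n)%E).
Qed.

End power_integral.

(** * McDiarmid's inequality *)

(** Integrated against a centred variable bounded by c, the linear term vanishes and leaves the
    sub-Gaussian bound exp(2 c^2). For y > 1/2 already y <= 2 y^2; otherwise exp(y) <= 1/(1 - y) <=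
    1 + y + 2 y^2. The factor 2 is not sharp, which only affects the universal constant. *)
Lemma expR_le_add_sqr {R : realType} (y : R) :
  expR y <= y + expR (2 * y ^+ 2).
Proof.
have [y_gt|y_le] := ltP 2^-1 y.
  rewrite (@le_trans _ _ (expR (2 * y ^+ 2)))//; last by lra.
  rewrite ler_expR; have : 0 <= y * (2 * y - 1) by apply: mulr_ge0; lra.
  by rewrite mulrBr expr2; lra.
have h1 := expR_ge1Dx (- y); have h2 := expR_ge1Dx (2 * y ^+ 2).
have h3 : expR y * expR (- y) = 1 by rewrite -expRD subrr expR0.
have h4 := expR_gt0 y.
have h5 : expR y * (1 - y) <= 1 by rewrite -[leRHS]h3 ler_pM2l.
have h6 : 1 <= (1 + y + 2 * y ^+ 2) * (1 - y).
  rewrite (_ : _ * _ = 1 + y ^+ 2 * (1 - 2 * y)); last by ring.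
  by rewrite lerDl mulr_ge0 ?sqr_ge0//; lra.
have h7 : expR y <= 1 + y + 2 * y ^+ 2.
  by rewrite -(@ler_pM2r _ (1 - y)); [exact: le_trans h6|lra].
by lra.
Qed.

Lemma measurable_le_set {d : measure_display} {T : measurableType d}
    {R : realType} (f : T -> R) (a : R) :
  bmeasurable f -> measurable [set x | f x <= a].
Proof.
move=> [mf _]; rewrite (_ : [set x | _] = f @^-1` `]-oo, a]%classic).
  by rewrite -[X in measurable X]setTI; exact: mf.
by apply/seteqP; split=> x /=; rewrite in_itv.
Qed.

(** Markov's inequality for exp(f). The Chernoff parameter is 1 because the scaling is put into [f]
    itself. *)
Lemma bmeasurable_chernoff {d : measure_display} {T : measurableType d}
    {R : realType} (P : probability T R) (f : T -> R) (a : R) : bmeasurable f ->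
  ((1 - (\int[P]_x expR (f x)) * expR (- a))%:E <= P [set x | f x <= a]%R)%E.
Proof.
move=> bf.
pose fm : {RV P >-> R} := HB.pack f (isMeasurableFun.Build _ _ _ _ f bf.1).
have := chernoff fm a (@ltr01 R).
rewrite /mmt_gen_fun mul1r => h.
have mA : measurable [set x | f x <= a].
  exact: measurable_le_set.
have {}h : (P (~` [set x | f x <= a]%R) <=
    ((\int[P]_x expR (f x)) * expR (- a))%:E)%E.
  apply: le_trans (le_trans h _).
    apply: le_measure; rewrite ?inE//; first exact: measurableC.
    - rewrite (_ : [set x | _] = f @^-1` `[a, +oo[%classic); last first.
        by apply/seteqP; split=> x /=; rewrite in_itv/= andbT.
      by rewrite -[X in measurable X]setTI; exact: bf.1.
    - by move=> x /= /negP; rewrite -ltNge => /ltW.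
  rewrite EFinM lee_pmul2r ?lte_fin ?expR_gt0// EFin_Rintegral; last first.
    exact: bmeasurable_expR.
  rewrite unlock /=; under eq_integral do rewrite /= mulr1.
  exact: lexx.
rewrite -[X in P X]setCK probability_setC ?measurableC//; last exact: measurableC.
by rewrite EFinB; apply: leeB.
Qed.

Section mcdiarmid.
Context {d : measure_display} {T : measurableType d} {R : realType}.
Variable P : probability T R.

(** The centred function at x is the mean over y of f(x) - f(y), hence bounded by [c], and
    [expR_le_add_sqr] can be integrated. *)
Lemma hoeffding_mgf (f : T -> R) (c : R) : bmeasurable f ->
  (forall x y, `|f x - f y| <= c) ->
  \int[P]_x expR (f x) <= expR (\int[P]_x f x + 2 * c ^+ 2).
Proof.
move=> bf fc; pose m := \int[P]_x f x; pose g x := f x - m.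
have bg : bmeasurable g by apply: bmeasurableB => //; exact: bmeasurable_cst.
have gc x : `|g x| <= c.
  rewrite /g /m -[X in X - _](Rintegral_cst_prob P) -RintegralB_bm//; last first.
    exact: bmeasurable_cst.
  apply: Rintegral_norm_le => //.
  by apply: bmeasurableB => //; exact: bmeasurable_cst.
have fE x : expR (f x) = expR m * expR (g x) by rewrite -expRD /g addrC subrK.
under eq_Rintegral do rewrite fE.
rewrite RintegralZ_bm; last exact: bmeasurable_expR.
rewrite expRD ler_pM2l ?expR_gt0//.
have -> : expR (2 * c ^+ 2) = \int[P]_x (g x + expR (2 * c ^+ 2)).
  rewrite RintegralD_bm//; last exact: bmeasurable_cst.
  rewrite RintegralB_bm//; last exact: bmeasurable_cst.
  by rewrite !Rintegral_cst_prob -/m subrr add0r.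
apply: le_Rintegral_bm => [||x]; first exact: bmeasurable_expR.
  by apply: bmeasurableD => //; exact: bmeasurable_cst.
rewrite (le_trans (expR_le_add_sqr _))// lerD2l ler_expR ler_pM2l//.
by rewrite -(real_normK (num_real (g x))) lerXn2r// nnegrE (le_trans _ (gc x)).
Qed.

Definition bounded_differences n (f : n.-tuple T -> R) (c : R) :=
  forall i t t', (forall j, j != i -> tnth t j = tnth t' j) ->
    `|f t - f t'| <= c.

(** Induction on the number of coordinates takes the place of a martingale argument. With the first
    coordinate x frozen, the induction hypothesis bounds the inner integral through the partial mean
    [F x]; since x is a single coordinate, [F] oscillates by at most [c], and [hoeffding_mgf]
    integrates it out at the price of one more 2 c^2. *)
Lemma mcdiarmid_mgf n (f : n.-tuple T -> R) (c : R) : bmeasurable f ->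
  bounded_differences f c ->
  \int[power P n]_t expR (f t) <=
  expR (\int[power P n]_t f t + n%:R * (2 * c ^+ 2)).
Proof.
elim: n f => [|n IH] f bf fc.
  have fE t : f t = f [tuple] by congr f; exact: tuple0.
  under eq_Rintegral do rewrite fE.
  under [in leRHS]eq_Rintegral do rewrite fE.
  by rewrite !Rintegral_cst_prob mul0r addr0.
pose fcons z := f (consT z).
have bfc : bmeasurable fcons.
  by apply: bmeasurable_comp bf; exact: measurable_consT.
have bfx x : bmeasurable (fun t => fcons (x, t)) := bmeasurable_pair1 bfc x.
have bF := bmeasurable_Rintegral P (power P n) bfc.
rewrite !Rintegral_power_cons//; last exact: bmeasurable_expR.
set F := fun x => \int[power P n]_t fcons (x, t).
have Fc x y : `|F x - F y| <= c.
  rewrite /F -RintegralB_bm//; apply: Rintegral_norm_le => [|t].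
    exact: bmeasurableB.
  apply: (fc ord0) => j; case: (unliftP ord0 j) => [k ->|->]; last first.
    by rewrite eqxx.
  by rewrite /consT !tnthS.
apply: (@le_trans _ _ (\int[P]_x expR (F x + n%:R * (2 * c ^+ 2)))).
  apply: le_Rintegral_bm => [||x].
  - apply: (bmeasurable_Rintegral P (power P n)
      (f := fun z => expR (fcons z))); exact: bmeasurable_expR.
  - by apply/bmeasurable_expR/bmeasurableD => //; exact: bmeasurable_cst.
  - apply: (IH (fun t => fcons (x, t))) => // i t t' tt'.
    apply: (fc (lift ord0 i)) => j.
    case: (unliftP ord0 j) => [k ->|-> _] //.
    by rewrite /consT !tnthS (inj_eq lift_inj) => /tt'.
have bF' : bmeasurable (fun x => F x + n%:R * (2 * c ^+ 2)).
  by apply: bmeasurableD => //; exact: bmeasurable_cst.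
apply: le_trans (hoeffding_mgf bF' _) _ => [x y|].
  by rewrite opprD addrACA subrr addr0; exact: Fc.
rewrite RintegralD_bm//; last exact: bmeasurable_cst.
by rewrite Rintegral_cst_prob ler_expR -natr1; lra.
Qed.

(** The coordinates are exchanged one by one. With c = 0 this makes [f] constant, the degenerate
    case of McDiarmid's inequality. *)
Lemma bounded_differences_dist n (f : n.-tuple T -> R) (c : R) t t' :
  bounded_differences f c -> `|f t - f t'| <= n%:R * c.
Proof.
elim: n f t t' => [|n IH] f t t' fc.
  by rewrite (tuple0 t) (tuple0 t') subrr normr0 mul0r.
case/tupleP: t => x t; case/tupleP: t' => x' t'.
rewrite -(subrKA (f [tuple of x' :: t])) (le_trans (ler_normD _ _))//.
rewrite -natr1 mulrDl mul1r addrC; apply: lerD.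
  apply: (IH (fun t => f [tuple of x' :: t])) => i u u' uu'.
  apply: (fc (lift ord0 i)) => j; case: (unliftP ord0 j) => [k ->|-> _] //.
  by rewrite !tnthS (inj_eq lift_inj) => /uu'.
apply: (fc ord0) => j; case: (unliftP ord0 j) => [k ->|->]; last by rewrite eqxx.
by rewrite !tnthS.
Qed.

(** The failure probability is written exp(-L) so that L becomes log(1/delta). The best factor
    obtainable from the moment bound above is 2 sqrt 2, rounded up to 3. *)
Lemma mcdiarmid n (f : n.-tuple T -> R) (c L : R) : (0 < n)%N ->
  0 <= c -> 0 <= L -> bmeasurable f -> bounded_differences f c ->
  ((1 - expR (- L))%:E <= power P n [set t |
    f t <= \int[power P n]_t f t + 3 * c * Num.sqrt (n%:R * L)]%R)%E.
Proof.
move=> n0 c0 L0 bf fc; have n0' : 0 < n%:R :> R by rewrite ltr0n.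
set m := \int[power P n]_t f t; set r := Num.sqrt _.
(* The Chernoff scale chosen below divides by [c]. *)
have [c_eq0|c_neq0] := eqVneq c 0.
  rewrite [X in power P n X](_ : _ = setT); last first.
    apply/seteqP; split=> // t _ /=.
    rewrite c_eq0 mulr0 mul0r addr0 -(Rintegral_cst_prob (power P n) (f t)).
    apply: le_Rintegral_bm => // [|t']; first exact: bmeasurable_cst.
    have := bounded_differences_dist t t' fc.
    by rewrite c_eq0 mulr0 normr_le0 subr_eq0 => /eqP ->.
  by rewrite probability_setT lee_fin lerBlDr lerDl expR_ge0.
have {c0 c_neq0} c0 : 0 < c by rewrite lt_neqAle eq_sym c_neq0.
have r2 : r ^+ 2 = n%:R * L by rewrite sqr_sqrtr// mulr_ge0// ltW.
(* The exponent 2 n (s c)^2 - s (3 c r) is exactly -L at this s. *)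
pose s := r / (2 * n%:R * c).
have s0 : 0 <= s by rewrite /s divr_ge0// ?sqrtr_ge0// !mulr_ge0// ltW.
have bsf : bmeasurable (fun t => s * f t) := bmeasurableZ s bf.
have sfc : bounded_differences (fun t => s * f t) (s * c).
  move=> i t t' tt'; rewrite -mulrBr normrM ger0_norm// ler_wpM2l//.
  exact: fc tt'.

(* The scale vanishes only if L = 0, and then the claimed probability is 0. *)
have [s_eq0|s_neq0] := eqVneq s 0.
  have r_eq0 : r = 0.
    move/eqP: s_eq0; rewrite /s mulf_eq0 invr_eq0 !mulf_eq0.
    by rewrite (gt_eqF c0) (gt_eqF n0') pnatr_eq0 !orbF => /eqP.
  have /eqP : n%:R * L = 0 by rewrite -r2 r_eq0 expr0n.
  by rewrite mulf_eq0 (gt_eqF n0') => /eqP ->; rewrite oppr0 expR0 subrr.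
have {s0 s_neq0} s0 : 0 < s by rewrite lt_neqAle eq_sym s_neq0.
rewrite [X in power P n X](_ : _ =
    [set t | s * f t <= s * (m + 3 * c * r)]); last first.
  by apply/seteqP; split=> t /=; rewrite ler_pM2l.
apply: le_trans _ (bmeasurable_chernoff (power P n) _ bsf).
rewrite lee_fin lerB// (le_trans (ler_wpM2r (expR_ge0 _) (mcdiarmid_mgf bsf sfc)))//.
rewrite -expRD RintegralZ_bm// -/m ler_expR le_eqVlt; apply/orP; left; apply/eqP.
have -> : s * m + n%:R * (2 * (s * c) ^+ 2) - s * (m + 3 * c * r) =
   2 * n%:R * c ^+ 2 * s ^+ 2 - 3 * c * s * r by ring.
have scr : s * c = r / (2 * n%:R).
  by rewrite /s; field; rewrite !gt_eqF.
have -> : 2 * n%:R * c ^+ 2 * s ^+ 2 - 3 * c * s * r =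
   2 * n%:R * (s * c) ^+ 2 - 3 * (s * c) * r by ring.
rewrite scr.
have -> : 2 * n%:R * (r / (2 * n%:R)) ^+ 2 - 3 * (r / (2 * n%:R)) * r =
   - r ^+ 2 / n%:R by field; rewrite gt_eqF.
by rewrite r2; field; rewrite gt_eqF.
Qed.

End mcdiarmid.

(** * Symmetrization *)

Definition ffun_cons n (b : bool) (s : {ffun 'I_n -> bool}) :
    {ffun 'I_n.+1 -> bool} :=
  [ffun i => if unlift ord0 i is Some j then s j else b].

(** Peels off the first sign; the inductions for symmetrization and for contraction both rest on
    it. *)
Lemma big_ffun_cons (V : Type) (idx : V) (op : Monoid.com_law idx) n
    (F : {ffun 'I_n.+1 -> bool} -> V) :
  \big[op/idx]_s F s = op (\big[op/idx]_s F (ffun_cons true s))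
                          (\big[op/idx]_s F (ffun_cons false s)).
Proof.
pose behead (s : {ffun 'I_n.+1 -> bool}) :=
  (s ord0, [ffun i => s (lift ord0 i)] : {ffun 'I_n -> bool}).
have consK : cancel (fun p => ffun_cons p.1 p.2) behead.
  move=> [b s]; rewrite /behead ffunE unlift_none /=; congr pair.
  by apply/ffunP => i; rewrite !ffunE liftK.
have beheadK : cancel behead (fun p => ffun_cons p.1 p.2).
  move=> s; apply/ffunP => i; rewrite !ffunE /=.
  by case: unliftP => [j ->|->//]; rewrite ffunE.
rewrite (reindex (fun p => ffun_cons p.1 p.2)) /=; last first.
  by exists behead => s _; [exact: consK|exact: beheadK].
by rewrite -(pair_big xpredT xpredT (fun b s => F (ffun_cons b s))) /= big_bool.
Qed.

(** * Sequences of functions with a common bound *)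

Section uniformly_bounded.
Context {d : measure_display} {T : measurableType d} {R : realType}.
Implicit Types (u v : nat -> T -> R).

(** The bound is uniform in the index too, so the pointwise supremum over the sequence is a true one
    and again bounded and measurable. *)
Definition ubmeasurable u :=
  (forall j, measurable_fun setT (u j)) /\ exists M, forall j x, `|u j x| <= M.

Lemma ubmeasurable_bm u j : ubmeasurable u -> bmeasurable (u j).
Proof. by move=> [mu [M uM]]; split => //; exists M. Qed.

Lemma ubmeasurable_sup u : ubmeasurable u ->
  bmeasurable (fun x => sup (range (u ^~ x))).
Proof. by move=> [mu [M uM]]; exact: bmeasurable_sup uM. Qed.

Lemma ubmeasurable_cst (a : nat -> R) M :
  (forall j, `|a j| <= M) -> ubmeasurable (fun j (_ : T) => a j).
Proof. by move=> aM; split=> [j|]; [exact: measurable_cst|exists M]. Qed.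

Lemma ubmeasurableD u v : ubmeasurable u -> ubmeasurable v ->
  ubmeasurable (fun j x => u j x + v j x).
Proof.
move=> [mu [M uM]] [mv [N vN]]; split=> [j|]; first exact: measurable_funD.
by exists (M + N) => j x; rewrite (le_trans (ler_normD _ _))// lerD.
Qed.

Lemma ubmeasurableZ c u : ubmeasurable u -> ubmeasurable (fun j x => c * u j x).
Proof.
move=> [mu [M uM]]; split=> [j|].
  by apply: measurable_funM => //; exact: measurable_cst.
by exists (`|c| * M) => j x; rewrite normrM ler_wpM2l.
Qed.

Lemma ubmeasurableN u : ubmeasurable u -> ubmeasurable (fun j x => - u j x).
Proof.
move=> /(ubmeasurableZ (-1)); congr ubmeasurable.
by apply/funext => j; apply/funext => x; rewrite mulN1r.
Qed.

Lemma ubmeasurable_sum (I : Type) (s : seq I) (u : I -> nat -> T -> R) :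
  (forall i, ubmeasurable (u i)) ->
  ubmeasurable (fun j x => \sum_(i <- s) u i j x).
Proof.
move=> bu; elim: s => [|i s IH].
  have := @ubmeasurable_cst (fun=> 0) 0; rewrite normr0 => /(_ (fun=> lexx 0)).
  by congr ubmeasurable; apply/funext => j; apply/funext => x; rewrite big_nil.
have := ubmeasurableD (bu i) IH.
by congr ubmeasurable; apply/funext => j; apply/funext => x; rewrite big_cons.
Qed.

End uniformly_bounded.

Lemma ubmeasurable_comp {d1 d2 : measure_display} {T1 : measurableType d1}
    {T2 : measurableType d2} {R : realType} (u : nat -> T2 -> R) (f : T1 -> T2) :
  measurable_fun setT f -> ubmeasurable u -> ubmeasurable (fun j x => u j (f x)).
Proof.
move=> mf [mu [M uM]]; split=> [j|]; first exact: measurableT_comp.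
by exists M => j x.
Qed.

Section symmetrization.
Context {d : measure_display} {T : measurableType d} {R : realType}.
Variables (P : probability T R) (g : nat -> T -> R).
Hypothesis bg : ubmeasurable g.

Let L j := \int[P]_z g j z.

Let ubL : exists M, forall j, `|L j| <= M.
Proof.
case: (bg) => _ [M gM]; exists M => j.
by apply: Rintegral_norm_le => //; exact: ubmeasurable_bm.
Qed.

(* A + L - g(z) is the midpoint of A + 2L and A - 2g(z), and Jensen's inequality
   turns the supremum of A + 2L into the mean of that of A + 2g; so no
   independent copy of the sample is needed. *)
Lemma symmetrization_step (A : nat -> R) K : (forall j, `|A j| <= K) ->
  \int[P]_z sup (range (fun j => A j + (L j - g j z))) <=
  \int[P]_z (2^-1 * (sup (range (fun j => A j + 2 * g j z)) +
                     sup (range (fun j => A j - 2 * g j z)))).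
Proof.
move=> AK; have ubA := ubmeasurable_cst (T := T) AK.
have [M LM] := ubL; have ubLT := ubmeasurable_cst (T := T) LM.
have ub1 : ubmeasurable (fun j z => A j + 2 * g j z).
  by apply: ubmeasurableD => //; exact: ubmeasurableZ.
have ub2 : ubmeasurable (fun j z => A j - 2 * g j z).
  by apply/ubmeasurableD => //; apply/ubmeasurableN/ubmeasurableZ.
have ub3 : ubmeasurable (fun j z => A j + (L j - g j z)).
  by apply/ubmeasurableD/ubmeasurableD/ubmeasurableN.
have bs1 := ubmeasurable_sup ub1; have bs2 := ubmeasurable_sup ub2.
rewrite RintegralZ_bm ?RintegralD_bm//; last exact: bmeasurableD.
set S := \int[P]_z sup (range (fun j => A j + 2 * g j z)).
have AL j : A j + 2 * L j <= S.
  rewrite -(Rintegral_cst_prob P (A j)) -RintegralZ_bm; last exact: ubmeasurable_bm.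
  rewrite -RintegralD_bm; [|exact: bmeasurable_cst|]; last first.
    by apply/bmeasurableZ/ubmeasurable_bm.
  apply: le_Rintegral_bm => // [|z]; first exact: (ubmeasurable_bm _ ub1).
  case: ub1 => _ [N ubN].
  exact: (sup_range_ub (u := fun j => A j + 2 * g j z) j
           (fun j => le_trans (ler_norm _) (ubN j z))).
rewrite mulrDr -(Rintegral_cst_prob P (2^-1 * S)) -RintegralZ_bm//.
rewrite -RintegralD_bm; [|exact: bmeasurable_cst|exact: bmeasurableZ].
apply: le_Rintegral_bm => [||z]; first exact: ubmeasurable_sup ub3.
  by apply: bmeasurableD; [exact: bmeasurable_cst|exact: bmeasurableZ].
apply: sup_range_le => j; case: ub2 => _ [N ubN].
have := sup_range_ub (u := fun j => A j - 2 * g j z) j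
           (fun j => le_trans (ler_norm _) (ubN j z)).
by have := AL j; lra.
Qed.

End symmetrization.

Section sign_average.
Context {d : measure_display} {T : measurableType d} {R : realType}.
Implicit Types (g : nat -> T -> R) (A : nat -> R).

(** The offset [A] stores the coordinates already symmetrized, which keeps them under the supremum
    during the induction. There is no factor 1/n: it is put into [g]. *)
Definition sign_average g n (t : n.-tuple T) A : R :=
  2 ^- n * \sum_(s : {ffun 'I_n -> bool})
    sup (range (fun j => A j + \sum_(i < n) (-1) ^+ s i * g j (tnth t i))).

Lemma sign_average_cons g n x (t : n.-tuple T) A :
  sign_average g (consT (x, t)) A =
  2^-1 * (sign_average g t (fun j => A j + g j x) +
          sign_average g t (fun j => A j - g j x)).
Proof.
rewrite /sign_average (@big_ffun_cons _ 0 (@GRing.add R)) exprS invfM -!mulrDr mulrA.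
congr (_ * _); rewrite addrC; congr (_ + _); apply: eq_bigr => s _;
  apply: eq_sup_range => j;
  rewrite big_ord_recl /= ffunE unlift_none /= ?expr0 ?expr1 ?mul1r ?mulN1r addrA;
  congr (_ + _); apply: eq_bigr => i _;
  by rewrite ffunE liftK /consT tnthS.
Qed.

(** Flipping all signs permutes the sign vectors. This is why one average W serves for the
    deviations in both directions. *)
Lemma sign_averageN g n (t : n.-tuple T) A :
  sign_average (fun j z => - g j z) t A = sign_average g t A.
Proof.
rewrite /sign_average; congr (_ * _).
pose flip (s : {ffun 'I_n -> bool}) : {ffun 'I_n -> bool} := [ffun i => ~~ s i].
have flipK : involutive flip.
  by move=> s; apply/ffunP => i; rewrite !ffunE negbK.
rewrite (reindex_inj (inv_inj flipK)) /=; apply: eq_bigr => s _.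
apply: eq_sup_range => j; congr (_ + _).
by apply: eq_bigr => i _; rewrite ffunE signrN mulrNN.
Qed.

Lemma bmeasurable_sign_average g n A K :
  ubmeasurable g -> (forall j, `|A j| <= K) ->
  bmeasurable (fun t : n.-tuple T => sign_average g t A).
Proof.
move=> bg AK; apply/bmeasurableZ/bmeasurable_sum => s.
apply/ubmeasurable_sup/ubmeasurableD; first exact: ubmeasurable_cst AK.
apply: ubmeasurable_sum => i; apply: ubmeasurableZ.
by apply: ubmeasurable_comp bg; exact: measurable_tnth.
Qed.

(** One coordinate is symmetrized at a time. The offset is arbitrary because the induction
    hypothesis is used at [A] plus and minus twice the value of [g] at the first observation. *)
Lemma symmetrization (P : probability T R) g n A K :
  ubmeasurable g -> (forall j, `|A j| <= K) ->
  \int[power P n]_t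
    sup (range (fun j => A j + \sum_(i < n) (\int[P]_z g j z - g j (tnth t i))))
  <= \int[power P n]_t sign_average (fun j z => 2 * g j z) t A.
Proof.
move=> bg; pose L j := \int[P]_z g j z.
have [M LM] : exists M, forall j, `|L j| <= M.
  case: (bg) => _ [M gM]; exists M => j.
  by apply: Rintegral_norm_le => //; exact: ubmeasurable_bm.
have [N gN] := bg.2.
have b2g := ubmeasurableZ 2 bg.
have bsum m : ubmeasurable
    (fun j (t : m.-tuple T) => \sum_(i < m) (L j - g j (tnth t i))).
  apply: ubmeasurable_sum => i; apply: ubmeasurableD.
    exact: ubmeasurable_cst LM.
  apply: ubmeasurableN; apply: ubmeasurable_comp bg; exact: measurable_tnth.
elim: n A K => [|n IH] A K AK.
  rewrite le_eqVlt; apply/orP; left; apply/eqP; apply: eq_Rintegral => t _.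
  rewrite /sign_average expr0 invr1 mul1r.
  under eq_bigr do under eq_fun do rewrite big_ord0.
  rewrite sumr_const card_ffun card_ord expn0 mulr1n.
  by under eq_fun do rewrite big_ord0.
pose S (p : T * n.-tuple T) j := \sum_(i < n) (L j - g j (tnth p.2 i)).
have bS : ubmeasurable (fun j p => S p j).
  by apply: ubmeasurable_comp (bsum n).
have bA : ubmeasurable (fun j (_ : T * n.-tuple T) => A j).
  exact: ubmeasurable_cst AK.
have bg1 : ubmeasurable (fun j (p : T * n.-tuple T) => g j p.1).
  by apply: ubmeasurable_comp bg.
have b2g1 := ubmeasurableZ 2 bg1.
have bL1 : ubmeasurable (fun j (p : T * n.-tuple T) => L j).
  exact: ubmeasurable_cst LM.
pose h0 p := sup (range (fun j => (A j + S p j) + (L j - g j p.1))).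
have bh0 : bmeasurable h0.
  apply/ubmeasurable_sup/ubmeasurableD; first exact: ubmeasurableD.
  by apply: ubmeasurableD => //; exact: ubmeasurableN.
pose hp p := sup (range (fun j => (A j + S p j) + 2 * g j p.1)).
have bhp : bmeasurable hp.
  by apply/ubmeasurable_sup/ubmeasurableD => //; exact: ubmeasurableD.
pose hm p := sup (range (fun j => (A j + S p j) - 2 * g j p.1)).
have bhm : bmeasurable hm.
  apply/ubmeasurable_sup/ubmeasurableD; first exact: ubmeasurableD.
  exact: ubmeasurableN.
pose h1 p := 2^-1 * (hp p + hm p).
have bh1 : bmeasurable h1 by apply/bmeasurableZ/bmeasurableD.
have bSA := bmeasurable_sign_average n.+1 b2g AK.
rewrite !Rintegral_power_cons//; last first.
  by apply/ubmeasurable_sup/ubmeasurableD => //; exact: ubmeasurable_cst AK.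
apply: (@le_trans _ _ (\int[P]_x \int[power P n]_t h0 (x, t))).
  rewrite le_eqVlt; apply/orP; left; apply/eqP.
  apply: eq_Rintegral => x _; apply: eq_Rintegral => t _.
  apply: eq_sup_range => j; rewrite big_ord_recl /= -[RHS]addrA.
  congr (_ + _); rewrite [RHS]addrC; congr (_ + _).
  by apply: eq_bigr => i _; rewrite /consT tnthS.
(* The other observations are frozen first, their contribution [S] joining the offset, so that
   [symmetrization_step] acts on the first observation alone. *)
rewrite Rintegral_swap//.
apply: (@le_trans _ _ (\int[power P n]_t \int[P]_x h1 (x, t))).
  have swap_bm (h : T * n.-tuple T -> R) : bmeasurable h ->
      bmeasurable (fun t => \int[P]_x h (x, t)).
    move=> bh.
    have bh' : bmeasurable (fun p => h (p.2, p.1)).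
      by apply: bmeasurable_comp bh; exact: measurable_fun_pair.
    exact: (bmeasurable_Rintegral (power P n) P bh').
  apply: le_Rintegral_bm => [||t]; [exact: swap_bm|exact: swap_bm|].
  have [_ [B BA]] := ubmeasurableD bA bS.
  (* [S] ignores the first component of its argument, which [point] merely fills. *)
  apply: (@symmetrization_step _ _ _ P g bg (fun j => A j + S (point, t) j) B).
  by move=> j; exact: (BA j (point, t)).
(* Back to the first order: now the first observation is frozen and the induction hypothesis handles
   the others. *)
rewrite -Rintegral_swap//; apply: le_Rintegral_bm => [||x].
- exact: bmeasurable_Rintegral.
- apply: (bmeasurable_Rintegral P (power P n) (f := fun p =>
    sign_average (fun j z => 2 * g j z) (consT p) A)).
  by apply: bmeasurable_comp bSA; exact: measurable_consT.
have bhp1 := bmeasurable_pair1 bhp x; have bhm1 := bmeasurable_pair1 bhm x.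
have AKp j : `|A j + 2 * g j x| <= K + 2 * N.
  by rewrite (le_trans (ler_normD _ _))// lerD// normrM ger0_norm// ler_pM2l.
have AKm j : `|A j - 2 * g j x| <= K + 2 * N.
  by rewrite (le_trans (ler_normB _ _))// lerD// normrM ger0_norm// ler_pM2l.
rewrite /h1 RintegralZ_bm; last exact: bmeasurableD.
rewrite RintegralD_bm//.
under [leRHS]eq_Rintegral do rewrite sign_average_cons.
have bSAp := bmeasurable_sign_average n b2g AKp.
have bSAm := bmeasurable_sign_average n b2g AKm.
rewrite RintegralZ_bm; last exact: bmeasurableD.
rewrite RintegralD_bm// ler_pM2l//.
apply: lerD; [apply: le_trans (IH _ _ AKp)|apply: le_trans (IH _ _ AKm)];
  rewrite le_eqVlt; apply/orP; left; apply/eqP; apply: eq_Rintegral => t _;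
  apply: eq_sup_range => j; by rewrite addrAC.
Qed.

End sign_average.

(** * Uniform deviations *)

Section bounded_differences_ops.
Context {d : measure_display} {T : measurableType d} {R : realType}.
Variable n : nat.
Implicit Types (f g : n.-tuple T -> R).

Lemma bounded_differencesD f g a b :
  bounded_differences f a -> bounded_differences g b ->
  bounded_differences (fun t => f t + g t) (a + b).
Proof.
move=> fa gb i t t' tt'; rewrite opprD addrACA (le_trans (ler_normD _ _))//.
by rewrite lerD ?(fa i) ?(gb i).
Qed.

Lemma bounded_differencesZ k f a : bounded_differences f a ->
  bounded_differences (fun t => k * f t) (`|k| * a).
Proof. by move=> fa i t t' tt'; rewrite -mulrBr normrM ler_wpM2l ?(fa i). Qed.

Lemma bounded_differences_sup (u : nat -> n.-tuple T -> R) c :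
  ubmeasurable u -> (forall j, bounded_differences (u j) c) ->
  bounded_differences (fun t => sup (range (u ^~ t))) c.
Proof.
move=> [_ [M uM]] uc i t t' tt'.
apply: (@sup_range_dist _ _ _ M) => j; last exact: (uc j i).
  exact: le_trans (ler_norm _) (uM j t).
exact: le_trans (ler_norm _) (uM j t').
Qed.

Lemma bounded_differences_coord (u : 'I_n -> T -> R) c :
  (forall i x y, `|u i x - u i y| <= c) ->
  bounded_differences (fun t => \sum_(i < n) u i (tnth t i)) c.
Proof.
move=> uc i t t' tt'; rewrite (bigD1 i)//= [X in _ - X](bigD1 i)//=.
rewrite opprD addrACA -sumrB big1 ?addr0// => j ji.
by rewrite tt'// subrr.
Qed.

End bounded_differences_ops.

(** * Events of prescribed probability *)

Lemma holds_with_probabilityW {d : measure_display} {T : measurableType d}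
    {R : realType} (Q : probability T R) p p' (E E' : set T) :
  p' <= p -> E `<=` E' ->
  holds_with_probability Q p E -> holds_with_probability Q p' E'.
Proof.
move=> pp' EE' [A [mA AE pA]]; exists A; split=> //; first exact: subset_trans EE'.
by apply: le_trans pA; rewrite lee_fin.
Qed.

(** The union bound on the complements, reserved for the joint statement. *)
Lemma holds_with_probabilityI {d : measure_display} {T : measurableType d}
    {R : realType} (Q : probability T R) a b (E F : set T) :
  holds_with_probability Q (1 - a) E -> holds_with_probability Q (1 - b) F ->
  holds_with_probability Q (1 - (a + b)) (E `&` F).
Proof.
move=> [A [mA AE aA]] [B [mB BF bB]]; exists (A `&` B); split.
- exact: measurableI.
- by move=> x [/AE Ex /BF Fx].
have h := measureU2 Q (measurableC mA) (measurableC mB).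
have Qcompl (S : set T) r : measurable S ->
    ((1 - r)%:E <= Q S)%E = (Q (~` S) <= r%:E)%E.
  move=> mS; rewrite probability_setC// -(fineK (fin_num_measure Q S mS)).
  by rewrite -EFinB !lee_fin lerBlDr lerBlDl.
rewrite Qcompl; last exact: measurableI.
by rewrite setCI (le_trans h)// EFinD leeD// -Qcompl.
Qed.

Section uniform_deviation.
Context {d : measure_display} {T : measurableType d} {R : realType}.
Variables (P : probability T R).
Implicit Types (g : nat -> T -> R) (n : nat).

Definition sup_deviation g n (t : n.-tuple T) : R :=
  sup (range (fun j => \sum_(i < n) (\int[P]_z g j z - g j (tnth t i)))).

Definition rademacher_average g n (t : n.-tuple T) : R :=
  sign_average g t (fun=> 0).

Section fixed_class.
Variables (g : nat -> T -> R) (c : R) (n : nat).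
Hypothesis bg : ubmeasurable g.
Hypothesis gc : forall j x y, `|g j x - g j y| <= c.

Lemma ubmeasurable_deviation : ubmeasurable (fun j (t : n.-tuple T) =>
  \sum_(i < n) (\int[P]_z g j z - g j (tnth t i))).
Proof.
have [M gM] := bg.2.
apply: ubmeasurable_sum => i; apply: ubmeasurableD.
  apply: (@ubmeasurable_cst _ _ _ _ M) => j.
  by apply: Rintegral_norm_le => //; exact: ubmeasurable_bm.
apply: ubmeasurableN; apply: ubmeasurable_comp bg; exact: measurable_tnth.
Qed.

Let ub_sign (s : {ffun 'I_n -> bool}) : ubmeasurable (fun j (t : n.-tuple T) =>
  0 + \sum_(i < n) (-1) ^+ s i * g j (tnth t i)).
Proof.
apply: ubmeasurableD.
  by apply: (@ubmeasurable_cst _ _ _ _ 0) => j; rewrite normr0.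
apply: ubmeasurable_sum => i; apply: ubmeasurableZ.
by apply: ubmeasurable_comp bg; exact: measurable_tnth.
Qed.

Lemma bmeasurable_sup_deviation : bmeasurable (@sup_deviation g n).
Proof. exact: ubmeasurable_sup ubmeasurable_deviation. Qed.

Lemma bmeasurable_rademacher_average : bmeasurable (@rademacher_average g n).
Proof.
apply: (@bmeasurable_sign_average _ _ _ _ _ _ 0) => // j; by rewrite normr0.
Qed.

Lemma bounded_differences_sup_deviation :
  bounded_differences (@sup_deviation g n) c.
Proof.
apply: bounded_differences_sup ubmeasurable_deviation _ => j.
apply: (bounded_differences_coord (u := fun _ z => \int[P]_z g j z - g j z)).
by move=> _ x y; rewrite opprB addrC subrKA.
Qed.

Lemma bounded_differences_rademacher_average :
  bounded_differences (@rademacher_average g n) c.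
Proof.
move=> i t t' tt'; rewrite /rademacher_average /sign_average -mulrBr normrM.
rewrite ger0_norm ?invr_ge0 ?exprn_ge0// ler_pdivrMl ?exprn_gt0//.
rewrite -sumrB (le_trans (ler_norm_sum _ _ _))//.
have -> : 2 ^+ n * c = \sum_(s : {ffun 'I_n -> bool}) c.
  by rewrite sumr_const card_ffun card_bool card_ord -natrX mulr_natl.
apply: ler_sum => s _.
apply: (bounded_differences_sup (ub_sign s) _ tt') => j {}i {tt'}t {}t' tt'.
rewrite !add0r.
apply: (bounded_differences_coord (u := fun i z => (-1) ^+ s i * g j z) _ tt').
by move=> k x y; rewrite -mulrBr normrM normrX normrN1 expr1n mul1r.
Qed.

(** Symmetrization with zero offset; the factor 2 then leaves the supremum. *)
Lemma mean_sup_deviation :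
  \int[power P n]_t @sup_deviation g n t <=
  2 * \int[power P n]_t @rademacher_average g n t.
Proof.
have := @symmetrization _ _ _ P g n (fun=> 0) 0 bg.
rewrite normr0 => /(_ (fun=> lexx 0)) h.
rewrite -RintegralZ_bm; last exact: bmeasurable_rademacher_average.
apply: le_trans (le_trans h _).
  rewrite le_eqVlt; apply/orP; left; apply/eqP; apply: eq_Rintegral => t _.
  by apply: eq_sup_range => j; rewrite add0r.
apply: le_Rintegral_bm => [||t].
- apply: (@bmeasurable_sign_average _ _ _ _ _ _ 0); last by move=> _; rewrite normr0.
  exact: ubmeasurableZ.
- exact/bmeasurableZ/bmeasurable_rademacher_average.
rewrite /rademacher_average /sign_average mulrCA ler_pM2l ?invr_gt0 ?exprn_gt0//.
rewrite mulr_sumr; apply: ler_sum => s _; apply: sup_range_le => j.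
have [_ [M ubM]] := ub_sign s.
have := sup_range_ub (u := fun j => 0 + \sum_(i < n) (-1) ^+ s i * g j (tnth t i))
  j (fun j => le_trans (ler_norm _) (ubM j t)).
rewrite -(ler_pM2l (ltr0n _ 2)) => /(le_trans _); apply.
rewrite !add0r mulr_sumr le_eqVlt; apply/orP; left; apply/eqP.
by apply: eq_bigr => i _; rewrite mulrCA.
Qed.

End fixed_class.

Variables (g : nat -> T -> R) (c L : R) (n : nat) (W : n.-tuple T -> R).
Hypothesis bg : ubmeasurable g.
Hypothesis c0 : 0 <= c.
Hypothesis gc : forall j x y, `|g j x - g j y| <= c.
Hypothesis n0 : (0 < n)%N.
Hypothesis L0 : 0 <= L.
Hypothesis WE : W = @rademacher_average g n \/
  W = fun=> \int[power P n]_t @rademacher_average g n t.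

Let bW : bmeasurable W.
Proof.
case: WE => ->; first exact: bmeasurable_rademacher_average.
exact: bmeasurable_cst.
Qed.

Let Wc : bounded_differences W c.
Proof.
case: WE => ->; first exact: bounded_differences_rademacher_average.
by move=> i t t' _; rewrite subrr normr0.
Qed.

Let meanW :
  \int[power P n]_t W t = \int[power P n]_t @rademacher_average g n t.
Proof. by case: WE => ->//; rewrite Rintegral_cst_prob. Qed.

(** Both choices of [W] have the same mean and differences at most [c], which is all that is used: U
    - 2W has nonpositive mean, so its concentration alone gives the bound. *)
Lemma uniform_deviation : holds_with_probability (power P n) (1 - expR (- L))
  [set t | sup_deviation g t <= 2 * W t + 18 * c * Num.sqrt (n%:R * L)].
Proof.
have bU := bmeasurable_sup_deviation n bg.
have Uc := bounded_differences_sup_deviation bg gc (n := n).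
pose f (t : n.-tuple T) := sup_deviation g t + (-2) * W t.
have bf : bmeasurable f by apply/bmeasurableD/bmeasurableZ.
have fc : bounded_differences f (c + `|-2| * c).
  exact/bounded_differencesD/bounded_differencesZ.
(* McDiarmid's inequality with differences 3c gives 9c here; 18c is stated to agree with
   [uniform_deviation2]. *)
have c3 : 0 <= c + `|-2| * c by rewrite addr_ge0 ?mulr_ge0.
exists [set t | f t <= \int[power P n]_t f t +
  3 * (c + `|-2| * c) * Num.sqrt (n%:R * L)]; split.
- exact: measurable_le_set.
- move=> t /= /le_trans h.
  rewrite -lerBlDl -mulNr; apply: h.
  rewrite RintegralD_bm//; last exact: bmeasurableZ.
  rewrite RintegralZ_bm// meanW.
  have := mean_sup_deviation n bg; have := sqrtr_ge0 (n%:R * L).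
  rewrite normrN normr_nat => s0 m0; have := mulr_ge0 c0 s0; lra.
- exact: mcdiarmid.
Qed.

(** U + V - 4W has differences (1 + 1 + 4)c, whence 3 * 6 = 18, and a nonpositive mean because the
    losses and their negatives have the same sign average. *)
Lemma uniform_deviation2 :
  holds_with_probability (power P n) (1 - expR (- L))
  [set t | sup_deviation g t + sup_deviation (fun j z => - g j z) t <=
           4 * W t + 18 * c * Num.sqrt (n%:R * L)].
Proof.
have bNg := ubmeasurableN bg.
have Ngc j x y : `|- g j x - - g j y| <= c by rewrite -opprD normrN.
have bU := bmeasurable_sup_deviation n bg.
have Uc := bounded_differences_sup_deviation bg gc (n := n).
have bV := bmeasurable_sup_deviation n bNg.
have Vc := bounded_differences_sup_deviation bNg Ngc (n := n).
pose f (t : n.-tuple T) :=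
  sup_deviation g t + sup_deviation (fun j z => - g j z) t + (-4) * W t.
have bf : bmeasurable f by apply/bmeasurableD/bmeasurableZ => //; exact: bmeasurableD.
have fc : bounded_differences f (c + c + `|-4| * c).
  by apply/bounded_differencesD/bounded_differencesZ => //; exact: bounded_differencesD.
have c6 : 0 <= c + c + `|-4| * c by rewrite !addr_ge0 ?mulr_ge0.
exists [set t | f t <= \int[power P n]_t f t +
  3 * (c + c + `|-4| * c) * Num.sqrt (n%:R * L)]; split.
- exact: measurable_le_set.
- move=> t /= /le_trans h.
  rewrite -lerBlDl -mulNr; apply: h.
  rewrite RintegralD_bm; [|exact: bmeasurableD|exact: bmeasurableZ].
  rewrite RintegralD_bm// RintegralZ_bm// meanW.
  have := mean_sup_deviation n bg; have := mean_sup_deviation n bNg.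
  under [in X in _ <= X -> _]eq_Rintegral do
    rewrite /rademacher_average sign_averageN -/(rademacher_average _ _).
  by rewrite normrN normr_nat; lra.
- exact: mcdiarmid.
Qed.

End uniform_deviation.

(** * Contraction and empirical Rademacher complexity *)

Section contraction.
Context {R : realType} {I : Type}.
Variable G : set I.
Hypothesis G0 : G !=set0.
Implicit Types (A u v a c : I -> R).
Local Open Scope ereal_scope.

(** The suprema are taken one after the other. Moving a term across an inequality needs it to be
    finite, so the first supremum is shown to be finite once z = +oo is set aside. *)
Lemma ereal_sup_add_le u v (z : \bar R) :
  (forall x y, G x -> G y -> (u x + v y)%:E <= z) ->
  ereal_sup [set (u x)%:E | x in G] + ereal_sup [set (v y)%:E | y in G] <= z.
Proof.
move=> uvz; have [w Gw] := G0.
have [->|z_neqy] := eqVneq z +oo; first by rewrite leey.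
have uz y : G y -> ereal_sup [set (u x)%:E | x in G] <= z - (v y)%:E.
  move=> Gy; apply: ge_ereal_sup => _ [x Gx <-].
  by rewrite leeBrDr// -EFinD uvz.
have u_fin : ereal_sup [set (u x)%:E | x in G] \is a fin_num.
  rewrite fin_numE; apply/andP; split.
    by apply/eqP => /ereal_sup_ninfty/(_ (u w)%:E) => /(_ (ex_intro2 _ _ w Gw erefl)).
  rewrite -ltey (le_lt_trans (uz w Gw))// ltey.
  by apply: contra z_neqy; case: (z).
rewrite addeC -leeBrDr//; apply: ge_ereal_sup => _ [y Gy <-].
by rewrite leeBrDr// addeC -leeBrDr// uz.
Qed.

(** For points x and y the left side is at most A x + A y + |c x - c y|. The right side reaches this
    value by giving the plus sign to the point where [c] is larger. *)
Lemma ereal_sup_sign_swap A a c :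
  (forall x y, G x -> G y -> `|a x - a y| <= `|c x - c y|)%R ->
  ereal_sup [set (A x + (-1) ^+ true * a x)%R%:E | x in G] +
    ereal_sup [set (A x + (-1) ^+ false * a x)%R%:E | x in G] <=
  ereal_sup [set (A x + (-1) ^+ true * c x)%R%:E | x in G] +
    ereal_sup [set (A x + (-1) ^+ false * c x)%R%:E | x in G].
Proof.
move=> ac; apply: ereal_sup_add_le => x y Gx Gy.
have supE u w : G w -> (u w)%:E <= ereal_sup [set (u x)%:E | x in G].
  by move=> Gw; apply: ereal_sup_ubound; exists w.
have axy : (a y - a x <= `|c x - c y|)%R.
  by rewrite (le_trans _ (ac x y Gx Gy))// distrC ler_norm.
have [cxy|cxy] := leP (c y) (c x).
  apply: le_trans (leeD (supE (fun x => A x + (-1) ^+ true * c x)%R y Gy)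
                        (supE (fun x => A x + (-1) ^+ false * c x)%R x Gx)).
  rewrite -EFinD lee_fin !expr0 !expr1; move: axy; rewrite ger0_norm ?subr_ge0//; lra.
apply: le_trans (leeD (supE (fun x => A x + (-1) ^+ true * c x)%R x Gx)
                      (supE (fun x => A x + (-1) ^+ false * c x)%R y Gy)).
rewrite -EFinD lee_fin !expr0 !expr1; move: axy; rewrite ltr0_norm ?subr_lt0//; lra.
Qed.

(* The exchange [ereal_sup_sign_swap] replaces [a] by [c] one coordinate at a
   time; comparing increments needs no contraction maps, and the suprema of the
   unbounded side may be infinite. *)
Lemma contraction n (a c : 'I_n -> I -> R) A :
  (forall i x y, G x -> G y -> `|a i x - a i y| <= `|c i x - c i y|)%R ->
  \sum_(s : {ffun 'I_n -> bool})
    ereal_sup [set (A x + \sum_(i < n) (-1) ^+ s i * a i x)%R%:E | x in G] <=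
  \sum_(s : {ffun 'I_n -> bool})
    ereal_sup [set (A x + \sum_(i < n) (-1) ^+ s i * c i x)%R%:E | x in G].
Proof.
elim: n a c A => [|n IH] a c A ac.
  by apply: lee_sum => s _; under eq_fun do rewrite big_ord0;
     under [in leRHS]eq_fun do rewrite big_ord0.
have consE (e : 'I_n.+1 -> I -> R) b :
    \sum_(s : {ffun 'I_n -> bool}) ereal_sup [set
      (A x + \sum_(i < n.+1) (-1) ^+ ffun_cons b s i * e i x)%R%:E | x in G] =
    \sum_(s : {ffun 'I_n -> bool}) ereal_sup [set (A x + (-1) ^+ b * e ord0 x +
      \sum_(i < n) (-1) ^+ s i * e (lift ord0 i) x)%R%:E | x in G].
  apply: eq_bigr => s _; congr ereal_sup; apply: eq_imagel => x _; congr EFin.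
  rewrite big_ord_recl addrA ffunE unlift_none; congr (_ + _)%R.
  by apply: eq_bigr => i _; rewrite ffunE liftK.
rewrite !(@big_ffun_cons _ 0 (@GRing.add (\bar R))) !consE.
pose ac' i := ac (lift ord0 i).
apply: le_trans (leeD (IH _ _ _ ac') (IH _ _ _ ac')) _.
rewrite -!big_split /=; apply: lee_sum => s _.
have shape (e e' : I -> R) b :
    [set (A x + (-1) ^+ b * e x + e' x)%R%:E | x in G] =
    [set ((A x + e' x) + (-1) ^+ b * e x)%R%:E | x in G].
  by apply: eq_imagel => x _; rewrite addrAC.
rewrite !shape.
exact: ereal_sup_sign_swap (ac ord0).
Qed.

End contraction.

(** * Empirical Rademacher complexity: positivity, measurability, comparison with the losses *)

Section empirical_rademacher.
Context {R : realType} {X : pmetricType R}.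
Variable n : nat.
Implicit Types (G : set (X -> R)) (S : n.-tuple (borel X)).
Local Open Scope ereal_scope.

Lemma emp_rademacherE S G : emp_rademacher S G =
  (2 ^- n)%R%:E * \sum_(s : {ffun 'I_n -> bool}) ereal_sup
    [set (0 + \sum_(i < n) (-1) ^+ s i * (n%:R^-1 * g (tnth S i)))%R%:E | g in G].
Proof.
congr (_ * _); apply: eq_bigr => s _; congr ereal_sup; apply: eq_imagel => g _.
by rewrite add0r mulr_sumr; congr EFin; apply: eq_bigr => i _; rewrite mulrCA.
Qed.

(** Contraction against the zero family. Positivity lets the complexity be integrated even where it
    is infinite. *)
Lemma emp_rademacher_ge0 S G : G !=set0 -> 0 <= emp_rademacher S G.
Proof.
move=> G0; rewrite emp_rademacherE mule_ge0 ?lee_fin ?invr_ge0 ?exprn_ge0//.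
apply: le_trans (contraction G0 (fun=> 0%R)
  (a := fun _ _ => 0%R) (c := fun i g => n%:R^-1 * g (tnth S i))%R _).
  apply: sume_ge0 => s _; have [g Gg] := G0; apply: le_ereal_sup_tmp.
  exists 0%:E => //; exists g => //.
  by congr EFin; rewrite add0r big1// => i _; rewrite mulr0.
by move=> i x y _ _; rewrite subrr normr0.
Qed.

(** Reduces an arbitrary supremum to a countable one, which makes the complexity measurable in the
    sample. *)
Lemma emp_rademacher_dense S G (h : nat -> X -> R) :
  (0 < n)%N -> (forall j, G (h j)) ->
  (forall g e, G g -> (0 < e)%R ->
    exists j, forall x, (`|g x - h j x| <= e)%R) ->
  emp_rademacher S G = emp_rademacher S (range h).
Proof.
move=> n0 Gh hdense; congr (_ * _); apply: eq_bigr => s _.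
apply/eqP; rewrite eq_le; apply/andP; split; last first.
  by apply: ereal_sup_le => _ [_ [j _ <-] <-]; exists (h j).
apply: ge_ereal_sup => _ [g Gg <-]; apply/lee_addgt0Pr => e e0.
have [j gh] := hdense g e Gg e0.
apply: (@le_trans _ _
  ((n%:R^-1 * \sum_(i < n) (-1) ^+ s i * h j (tnth S i))%R%:E + e%:E)).
  rewrite -EFinD lee_fin -lerBlDl -mulrBr -sumrB.
  rewrite ler_pdivrMl ?ltr0n// mulr_natl -[in leRHS](card_ord n) -sumr_const.
  apply: ler_sum => i _; rewrite -mulrBr (le_trans (ler_norm _))//.
  by rewrite normrM normrX normrN1 expr1n mul1r.
by rewrite leeD2r// ereal_sup_ubound//; exists (h j) => //; exists j.
Qed.

Lemma measurable_emp_rademacher (h : nat -> X -> R) :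
  (forall j, measurable_fun setT (h j : borel X -> R)) ->
  measurable_fun setT (fun S => emp_rademacher S (range h)).
Proof.
move=> mh; apply: emeasurable_funM; first exact: measurable_cst.
apply: emeasurable_sum => s.
pose u S j := (n%:R^-1 * \sum_(i < n) (-1) ^+ s i * h j (tnth S i))%R%:E.
rewrite [X in measurable_fun _ X](_ : _ = fun S => esups (u S) 0%N); last first.
  apply/funext => S; rewrite /esups /= /sdrop; congr ereal_sup.
  apply/seteqP; split => [_ [_ [j _ <-] <-]|_ [j _ <-]]; first by exists j.
  by exists (h j) => //; exists j.
apply: (@measurable_fun_esups _ _ _ _ (fun j S => u S j)) => j.
apply/measurable_EFinP/measurable_funM; first exact: measurable_cst.
apply: measurable_sum => i; apply: measurable_funM; first exact: measurable_cst.
by apply: measurableT_comp => //; exact: measurable_tnth.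
Qed.

Lemma rademacher_average_le (l : R -> R -> R) (beta M : R) (h : nat -> X -> R)
    G (D : n.-tuple (borel X * R)%type) :
  (0 <= beta)%R -> (forall j, G (h j)) ->
  (forall a a' y, `|l a y - l a' y| <= beta * `|a - a'|)%R ->
  (forall a y, `|l a y| <= M)%R ->
  (rademacher_average
    (fun j (z : borel X * R) => n%:R^-1 * l (h j z.1) z.2)%R D)%:E <=
  beta%:E * emp_rademacher (inputs D) G.
Proof.
move=> beta0 Gh l_lip lM.
have G0 : G !=set0 by exists (h 0%N).
rewrite /rademacher_average /sign_average EFinM /emp_rademacher muleCA.
apply: lee_wpmul2l; first by rewrite lee_fin invr_ge0 exprn_ge0.
pose E s := ereal_sup
  [set (n%:R^-1 * \sum_(i < n) (-1) ^+ s i * g (tnth (inputs D) i))%R%:E | g in G].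
(* Some of these suprema may be +oo; excluding -oo allows [beta] to be distributed over their
   sum. *)
have E_gtNy s : -oo < E s.
  apply: lt_le_trans (ltNyr _) _; last apply: ereal_sup_ubound.
  by exists (h 0%N).
rewrite fin_num_sume_distrr//; last first.
  by move=> s s' _ _; apply: ltninfty_adde_def; rewrite inE; exact: E_gtNy.
pose a (i : 'I_n) j := (n%:R^-1 * l (h j (tnth D i).1) (tnth D i).2)%R.
(* With [beta] absorbed here, the Lipschitz condition becomes a comparison of increments with
   constant 1. *)
pose c (i : 'I_n) j := (n%:R^-1 * beta * h j (tnth D i).1)%R.
have ac i j k : (`|a i j - a i k| <= `|c i j - c i k|)%R.
  rewrite /a /c -!mulrBr !normrM -mulrA ler_wpM2l//.
  by rewrite (ger0_norm beta0).
have aM i j : (`|a i j| <= `|n%:R^-1| * M)%R by rewrite normrM ler_wpM2l.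
rewrite -sumEFin; apply: (@le_trans _ _ (\sum_(s : {ffun 'I_n -> bool}) ereal_sup
    [set (0 + \sum_(i < n) (-1) ^+ s i * a i j)%R%:E | j in [set: nat]])).
  apply: lee_sum => s _; rewrite -ereal_sup_EFin.
  - by rewrite image_comp.
  - exists (\sum_(i < n) `|n%:R^-1| * M)%R => _ [j _ <-].
    rewrite add0r (le_trans (ler_norm _))// (le_trans (ler_norm_sum _ _ _))//.
    by apply: ler_sum => i _; rewrite normrM normrX normrN1 expr1n mul1r aM.
  - by exists (0 + \sum_(i < n) (-1) ^+ s i * a i 0%N)%R, 0%N.
have T0 : [set: nat] !=set0 by exists 0%N.
apply: le_trans (contraction T0 (fun=> 0%R) (a := a) (c := c) _) _ => [i j k _ _|].
  exact: ac.
apply: lee_sum => s _; apply: ge_ereal_sup => _ [j _ <-].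
apply: (@le_trans _ _ (beta%:E *
  (n%:R^-1 * \sum_(i < n) (-1) ^+ s i * h j (tnth (inputs D) i))%R%:E)).
  rewrite -EFinM lee_fin add0r !mulr_sumr le_eqVlt; apply/orP; left; apply/eqP.
  apply: eq_bigr => i _; rewrite /c /inputs tnth_map mulrCA mulrA; ring.
apply: lee_wpmul2l => //; apply: ereal_sup_ubound.
by exists (h j).
Qed.

End empirical_rademacher.

Lemma measurable_inputs {R : realType} {X : pmetricType R} n :
  measurable_fun setT (@inputs R X n).
Proof.
apply/measurable_fun_tnthP => i.
rewrite (_ : _ \o _ = fst \o (fun D => tnth D i)).
  by apply: measurableT_comp => //; exact: measurable_tnth.
by apply/funext => D /=; rewrite /inputs tnth_map.
Qed.

(** The inputs of an i.i.d. sample are i.i.d. with the marginal law; induction on n, in the form of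
    integrals of nonnegative functions. *)
Lemma integral_power_inputs {R : realType} {X : pmetricType R}
    (P : probability (borel X * R)%type R) n (f : n.-tuple (borel X) -> \bar R) :
  measurable_fun setT f -> (forall S, 0 <= f S)%E ->
  (\int[power (marginal P) n]_S f S = \int[power P n]_D f (inputs D))%E.
Proof.
elim: n f => [|n IH] f mf f0.
  have fE S : f S = f [tuple] by congr f; exact: tuple0.
  under eq_integral do rewrite fE.
  under [RHS]eq_integral do rewrite fE.
  by rewrite !integral_cst// !probability_setT.
have mf1 : measurable_fun setT (fun p => f (consT p)).
  by apply: measurableT_comp => //; exact: measurable_consT.
rewrite (integral_power_cons (marginal P) mf f0).
rewrite (integral_power_cons P (measurableT_comp mf (@measurable_inputs R X _))
  (fun D => f0 (inputs D))).
rewrite /marginal ge0_integral_distribution; last 2 first.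
- exact: (measurable_fun_fubini_tonelli_F (m2 := power (marginal P) n)
    (fun p => f (consT p))).
- by move=> x; exact: integral_ge0.
apply: eq_integral => z _ /=.
rewrite IH//; last by apply: measurableT_comp mf1 _; exact: measurable_pair1.
by apply: eq_integral => D _; congr f; exact: val_inj.
Qed.

(** * Risk bounds *)

Section risk_bounds.
Context {R : realType} {X : pmetricType R}.
Variables (P : probability (borel X * R)%type R) (b beta : R) (l : R -> R -> R).
Hypothesis ml : measurable_fun [set: R * R] (fun p : R * R => l p.1 p.2).
Hypothesis lb : forall a y, 0 <= l a y <= b.
Hypothesis l_lip : forall a a' y, `|l a y - l a' y| <= beta * `|a - a'|.
Implicit Types (f : X -> R) (G : set (X -> R)).

Lemma loss_bound_ge0 : 0 <= b.
Proof. by have /andP[/le_trans] := lb 0 0; exact. Qed.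

Lemma loss_lipschitz_ge0 : 0 <= beta.
Proof.
have := l_lip 1 0 0; rewrite subr0 normr1 mulr1; exact: le_trans.
Qed.

Lemma bmeasurable_loss f : measurable_fun setT (f : borel X -> R) ->
  bmeasurable (fun z : borel X * R => l (f z.1) z.2).
Proof.
move=> mf; split; last first.
  by exists b => z; have /andP[l0 lb'] := lb (f z.1) z.2; rewrite ger0_norm.
have mfst : measurable_fun setT (fun z : borel X * R => f z.1).
  exact: measurableT_comp.
exact: (measurableT_comp ml (measurable_fun_pair mfst measurable_snd)).
Qed.

Definition mean_loss f : R := \int[P]_z l (f z.1) z.2.

Definition emp_loss n (D : n.-tuple (borel X * R)%type) f : R :=
  n%:R^-1 * \sum_(i < n) l (f (tnth D i).1) (tnth D i).2.

Lemma riskE f : measurable_fun setT (f : borel X -> R) ->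
  risk P l f = (mean_loss f)%:E.
Proof.
move=> mf; rewrite /risk unlock EFin_Rintegral//; exact: bmeasurable_loss.
Qed.

Lemma mean_loss_dist f f' r :
  measurable_fun setT (f : borel X -> R) ->
  measurable_fun setT (f' : borel X -> R) ->
  (forall x, `|f x - f' x| <= r) -> `|mean_loss f - mean_loss f'| <= beta * r.
Proof.
move=> mf mf' ff'; have bl := bmeasurable_loss mf; have bl' := bmeasurable_loss mf'.
rewrite /mean_loss -RintegralB_bm//; apply: Rintegral_norm_le => [|z].
  exact: bmeasurableB.
by rewrite (le_trans (l_lip _ _ _))// ler_wpM2l// loss_lipschitz_ge0.
Qed.

Lemma emp_loss_dist n (D : n.-tuple (borel X * R)%type) f f' r : (0 < n)%N ->
  (forall x, `|f x - f' x| <= r) -> `|emp_loss D f - emp_loss D f'| <= beta * r.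
Proof.
move=> n0 ff'; rewrite /emp_loss -mulrBr -sumrB normrM ger0_norm ?invr_ge0//.
rewrite ler_pdivrMl ?ltr0n// mulr_natl -[in leRHS](card_ord n) -sumr_const.
rewrite (le_trans (ler_norm_sum _ _ _))//; apply: ler_sum => i _.
by rewrite (le_trans (l_lip _ _ _))// ler_wpM2l// loss_lipschitz_ge0.
Qed.

Lemma inf_risk_fin_num G : G !=set0 ->
  G `<=` [set c | measurable_fun setT (c : borel X -> R)] ->
  inf_risk P l G \is a fin_num.
Proof.
move=> [g Gg] mG; rewrite fin_numElt; apply/andP; split.
  apply: lt_le_trans (ltNyr 0) _; apply: le_ereal_inf_tmp => _ [f Gf <-].
  rewrite riskE; last exact: mG.
  by rewrite lee_fin Rintegral_ge0// => z _; have /andP[] := lb (f z.1) z.2.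
apply: le_lt_trans (ltry (mean_loss g)).
by apply: ereal_inf_lbound; exists g => //; rewrite riskE//; exact: mG.
Qed.

Section countable_class.
Variables (n : nat) (h : nat -> X -> R) (G : set (X -> R)).
Hypothesis n0 : (0 < n)%N.
Hypothesis mG : G `<=` [set c | measurable_fun setT (c : borel X -> R)].
Hypothesis Gh : forall j, G (h j).
Hypothesis hdense : forall g e, G g -> 0 < e ->
  exists j, forall x, `|g x - h j x| <= e.

(** Carrying 1/n inside the class turns sums over the sample into averages and makes the differences
    b/n. *)
Definition scaled_loss (j : nat) (z : borel X * R) : R :=
  n%:R^-1 * l (h j z.1) z.2.

Lemma scaled_loss_norm j z : `|scaled_loss j z| <= n%:R^-1 * b.
Proof.
have /andP[? ?] := lb (h j z.1) z.2.
by rewrite /scaled_loss normrM !ger0_norm ?invr_ge0// ler_wpM2l ?invr_ge0.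
Qed.

Lemma ubmeasurable_scaled_loss : ubmeasurable scaled_loss.
Proof.
split=> [j|]; last by exists (n%:R^-1 * b); exact: scaled_loss_norm.
exact: (bmeasurableZ _ (bmeasurable_loss (mG (Gh j)))).1.
Qed.

Lemma scaled_loss_dist j z z' :
  `|scaled_loss j z - scaled_loss j z'| <= n%:R^-1 * b.
Proof.
have /andP[? ?] := lb (h j z.1) z.2; have /andP[? ?] := lb (h j z'.1) z'.2.
rewrite /scaled_loss -mulrBr normrM ger0_norm ?invr_ge0// ler_wpM2l ?invr_ge0//.
by rewrite ler_norml; lra.
Qed.

Let sum_deviation j (D : n.-tuple (borel X * R)%type) :
  \sum_(i < n) (\int[P]_z scaled_loss j z - scaled_loss j (tnth D i)) =
  mean_loss (h j) - emp_loss D (h j).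
Proof.
rewrite sumrB sumr_const card_ord -mulr_sumr RintegralZ_bm.
  by rewrite -[_ *+ n]mulr_natl mulVKf// pnatr_eq0 -lt0n.
by apply: bmeasurable_loss; exact: mG.
Qed.

Let approx f : G f -> forall e, 0 < e -> exists j,
  `|mean_loss f - mean_loss (h j)| <= e /\
  forall D : n.-tuple _, `|emp_loss D f - emp_loss D (h j)| <= e.
Proof.
move=> Gf e e0; have beta0 := loss_lipschitz_ge0.
(* [beta] may be 0, so the tolerance is divided by [beta + 1]. *)
have beta1 : 0 < beta + 1 by rewrite ltr_wpDl.
have [j fh] := hdense Gf (divr_gt0 e0 beta1); exists j.
have le_e : beta * (e / (beta + 1)) <= e.
  by rewrite mulrA ler_pdivrMr// mulrC ler_pM2l// lerDl.
split=> [|D]; apply: le_trans le_e.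
  by apply: mean_loss_dist fh; exact: mG.
exact: emp_loss_dist.
Qed.

(** The supremum runs over the dense sequence, but uniform approximation extends it to all of [G].
    The bound thus applies to a hypothesis chosen from the sample, even in a nonmeasurable way. *)
Lemma mean_emp_le f (D : n.-tuple (borel X * R)%type) : G f ->
  mean_loss f - emp_loss D f <= sup_deviation P scaled_loss D.
Proof.
move=> Gf; apply/ler_addgt0Pr => e e0.
have [j [hm /(_ D) he]] := approx Gf (divr_gt0 e0 (ltr0n _ 2)).
have [_ [M uM]] := ubmeasurable_deviation P n ubmeasurable_scaled_loss.
have := sup_range_ub (u := fun j => \sum_(i < n) (\int[P]_z scaled_loss j z -
  scaled_loss j (tnth D i))) j (fun j => le_trans (ler_norm _) (uM j D)).
rewrite -/(sup_deviation _ _ _) sum_deviation.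
by move: hm he; rewrite !ler_norml; lra.
Qed.

Lemma emp_mean_le f (D : n.-tuple (borel X * R)%type) : G f ->
  emp_loss D f - mean_loss f <=
  sup_deviation P (fun j z => - scaled_loss j z) D.
Proof.
move=> Gf; apply/ler_addgt0Pr => e e0.
have [j [hm /(_ D) he]] := approx Gf (divr_gt0 e0 (ltr0n _ 2)).
have [_ [M uM]] := ubmeasurable_deviation P n (ubmeasurableN ubmeasurable_scaled_loss).
have := sup_range_ub (u := fun j => \sum_(i < n) (\int[P]_z (- scaled_loss j z) -
  - scaled_loss j (tnth D i))) j (fun j => le_trans (ler_norm _) (uM j D)).
rewrite -/(sup_deviation _ _ _).
have -> : \sum_(i < n) (\int[P]_z (- scaled_loss j z) -
    - scaled_loss j (tnth D i)) = - (mean_loss (h j) - emp_loss D (h j)).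
  rewrite -sum_deviation -sumrN; apply: eq_bigr => i _.
  rewrite RintegralN_bm ?opprD//.
  exact: ubmeasurable_bm ubmeasurable_scaled_loss.
by move: hm he; rewrite !ler_norml; lra.
Qed.

End countable_class.

End risk_bounds.

(** * Dense sequences, implementation error and the final bounds *)

Lemma sup_norm_ge {R : realType} {X : pmetricType R} (f : X -> R) x :
  (`|f x|%:E <= sup_norm f)%E.
Proof. by apply: ereal_sup_ubound; exists x. Qed.

Lemma sup_separable_seq {R : realType} {X : pmetricType R} (G : set (X -> R)) :
  G !=set0 -> sup_separable G ->
  exists h : nat -> X -> R, (forall j, G (h j)) /\
    forall g e, G g -> 0 < e -> exists j, forall x, `|g x - h j x| <= e.
Proof.
move=> [g0 Gg0] [A [cA AG Adense]].
(* Approximating one member of [G] shows that the dense set is nonempty, hence the range of a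
   sequence. *)
have [g1 Ag1 _] := Adense g0 Gg0 1 ltr01.
have [A0|[h]] := pfcard_geP cA; first by move: Ag1; rewrite A0.
exists h; split=> [j|g e Gg e0]; first by apply: AG; exact: funS.
have [a Aa ga] := Adense g Gg e e0.
have [j _ hj] := surj (f := h) Aa; exists j => x.
rewrite hj -lee_fin; apply: le_trans (ltW ga).
exact: (sup_norm_ge (g \- a)%R).
Qed.

(** [eps_imp] may be infinite, but the error at a single [f] is finite. The witness [r] keeps the
    estimates in [R] until the last comparison. *)
Lemma sup_norm_imp {R : realType} {X : pmetricType R} (G : set (X -> R))
    (Phi : (X -> R) -> X -> R) f (beta : R) :
  0 <= beta -> G f -> Linfty f -> Linfty (Phi f) ->
  exists r : R, (forall x, `|f x - Phi f x| <= r) /\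
    ((beta * r)%:E <= beta%:E * eps_imp G Phi)%E.
Proof.
move=> beta0 Gf [_ [M [_ fM]]] [_ [N [_ gN]]].
set s := sup_norm (f \- Phi f)%R.
have s_fin : s \is a fin_num.
  rewrite fin_numElt; apply/andP; split.
    by apply: lt_le_trans (ltNyr _) (sup_norm_ge _ point).
  (* [bounded_fun] only provides bounds strictly above its witness, hence the added units. *)
  apply: (@le_lt_trans _ _ ((M + 1) + (N + 1))%:E); last exact: ltry.
  apply: ge_ereal_sup => _ [x _ <-]; rewrite lee_fin.
  rewrite (le_trans (ler_normB _ _))// lerD//.
    by apply: fM => //; rewrite ltrDl.
  by apply: gN => //; rewrite ltrDl.
exists (fine s); split=> [x|].
  by rewrite -lee_fin fineK//; exact: (sup_norm_ge (f \- Phi f)%R).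
rewrite EFinM fineK//; apply: lee_wpmul2l; first by rewrite lee_fin.
by apply: ereal_sup_ubound; exists f.
Qed.

(** Integrates [rademacher_average_le] over the sample; [rademacher] integrates over inputs only, so
    it is first rewritten as an integral over full samples. *)
Lemma mean_rademacher_average_le {R : realType} {X : pmetricType R}
    (P : probability (borel X * R)%type R) (b beta : R) (l : R -> R -> R)
    (G : set (X -> R)) (h : nat -> X -> R) n :
  measurable_fun [set: R * R] (fun p : R * R => l p.1 p.2) ->
  (forall a y, 0 <= l a y <= b) ->
  (forall a a' y, `|l a y - l a' y| <= beta * `|a - a'|) ->
  (0 < n)%N ->
  G `<=` [set c | measurable_fun setT (c : borel X -> R)] ->
  (forall j, G (h j)) ->
  (forall g e, G g -> 0 < e -> exists j, forall x, `|g x - h j x| <= e) ->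
  ((\int[power P n]_D rademacher_average (scaled_loss l n h) D)%:E <=
   beta%:E * rademacher n (marginal P) G)%E.
Proof.
move=> ml lb l_lip n0 mG Gh hdense.
have beta0 := loss_lipschitz_ge0 l_lip.
have bW := bmeasurable_rademacher_average n
  (ubmeasurable_scaled_loss ml lb n mG Gh).
set W := rademacher_average _ in bW *.
have bW0 : bmeasurable (fun D => Num.max (W n D) 0).
  case: bW => mW [M WM]; split.
    by apply: measurable_maxr => //; exact: measurable_cst.
  exists (Num.max M 0) => D; rewrite ger0_norm; last by rewrite le_max lexx orbT.
  by rewrite ge_max !le_max lexx orbT (le_trans (ler_norm _) (WM D)).
have G0 : G !=set0 by exists (h 0%N).
have radE (S : n.-tuple (borel X)) := emp_rademacher_dense S n0 Gh hdense.
have mrad : measurable_fun setT (fun S : n.-tuple (borel X) => emp_rademacher S G).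
  under eq_fun do rewrite radE.
  by apply: measurable_emp_rademacher => j; exact: mG.
have rad0 (S : n.-tuple (borel X)) := emp_rademacher_ge0 S G0.
rewrite /rademacher integral_power_inputs//.
rewrite -ge0_integralZl_EFin//; last first.
  exact: measurableT_comp mrad (@measurable_inputs R X _).
(* The complexity need not be integrable, so the comparison is made between
   nonnegative functions, through the positive part of W. *)
apply: (@le_trans _ _ (\int[power P n]_D Num.max (W n D) 0)%:E).
  rewrite lee_fin; apply: le_Rintegral_bm => // D.
  by rewrite le_max lexx.
rewrite EFin_Rintegral//; apply: ge0_le_integral => //.
- by move=> D _; rewrite lee_fin le_max lexx orbT.
- by apply/measurable_EFinP; case: bW0.
- apply: emeasurable_funM; first exact: measurable_cst.
  exact: measurableT_comp mrad (@measurable_inputs R X _).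
move=> D _; rewrite EFin_max ge_max; apply/andP; split; last by rewrite mule_ge0.
apply: (@rademacher_average_le _ _ n l beta b h G D) => // a y.
by have /andP[? ?] := lb a y; rewrite ger0_norm.
Qed.

Unset Implicit Arguments.

Theorem theorem1 (R : realType) :
  exists C : R,
  forall (X : pmetricType R) (P : probability (borel X * R)%type R)
    (F : set (X -> X)) (H : set (X -> R)) (k : nat)
    (b beta : R) (l : R -> R -> R)
    (Concept Himp : set (X -> R)) (Phi : (X -> R) -> (X -> R))
    (n : nat) (fhat : n.-tuple (borel X * R)%type -> (X -> R)),
  let Hk := comp_class H F k in
  F `<=` [set f | continuous f] ->
  H `<=` [set h | continuous h] ->
  measurable_fun [set: R * R] (fun p : R * R => l p.1 p.2) ->
  (forall a y, 0 <= l a y <= b) ->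
  (forall a a' y, `|l a y - l a' y| <= beta * `|a - a'|) ->
  Concept !=set0 ->
  Concept `<=` [set c | measurable_fun setT (c : borel X -> R)] ->
  Himp `<=` Linfty ->
  (forall f, Hk f -> Himp (Phi f)) ->
  Hk `<=` Linfty ->
  sup_separable Hk ->
  (0 < n)%N ->
  (forall D, is_erm l D Hk (fhat D)) ->
  forall delta : R, 0 < delta < 1 ->
  forall Rad : n.-tuple (borel X * R)%type -> \bar R,
  Rad = (fun D => emp_rademacher (inputs D) Hk) \/
  Rad = (fun D => rademacher n (marginal P) Hk) ->
  let hhat := fun D => Phi (fhat D) in
  let t := C * b * Num.sqrt (ln (1 / delta) / n%:R) in
  let excess_bound := [set D | (risk P l (hhat D) - inf_risk P l Concept <=
    beta%:E * eps_imp Hk Phi + eps_model P l Hk Concept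
    + (4 * beta)%:E * Rad D + t%:E)%E] in
  let gap_bound := [set D | (risk P l (hhat D) - emp_risk l D (hhat D) <=
    (2 * beta)%:E * eps_imp Hk Phi + (2 * beta)%:E * Rad D + t%:E)%E] in
  [/\ holds_with_probability (power P n) (1 - delta) excess_bound,
      holds_with_probability (power P n) (1 - delta) gap_bound &
      delta <= 1 / 2 ->
      holds_with_probability (power P n) (1 - delta)
        (excess_bound `&` gap_bound)].
Proof.
(* Twice the 18 of [uniform_deviation2]: the joint statement uses L = 2 log(1/delta), and the square
   root of 2 is rounded up to 2. *)
exists 36 => X P F H k b beta l Concept Himp Phi n fhat Hk FC HC ml lb l_lip.
move=> C0 mC HimpL PhiI HkL Hsep n0 erm delta /andP[d0 d1] Rad RadE.
move=> hhat t excess_bound gap_bound.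
have b0 := loss_bound_ge0 lb; have beta0 := loss_lipschitz_ge0 l_lip.
have mHk : Hk `<=` [set f | measurable_fun setT (f : borel X -> R)].
  by move=> f /HkL[].
have Hkf D : Hk (fhat D) by case: (erm D).
have Hk0 : Hk !=set0 by exists (fhat point).
have [h [Hkh hdense]] := sup_separable_seq Hk0 Hsep.
pose g := scaled_loss l n h; pose c := n%:R^-1 * b.
have c0 : 0 <= c by rewrite mulr_ge0 ?invr_ge0.
have bg : ubmeasurable g := ubmeasurable_scaled_loss ml lb n mHk Hkh.
have gc := scaled_loss_dist lb n h.
have mhat D : measurable_fun setT (hhat D : borel X -> R).
  by have [] := HimpL _ (PhiI _ (Hkf D)).
(* The real-valued average of losses stands in for [Rad], which may be infinite, and matches its
   empirical or mean form. *)
have [W [WE WRad]] : exists W : n.-tuple _ -> R,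
    (W = @rademacher_average _ _ _ g n \/
     W = fun=> \int[power P n]_D @rademacher_average _ _ _ g n D) /\
    forall D, ((W D)%:E <= beta%:E * Rad D)%E.
  case: RadE => ->.
    exists (@rademacher_average _ _ _ g n); split; first by left.
    move=> D; apply: (@rademacher_average_le _ _ n l beta b h Hk D) => // a y.
    by have /andP[? ?] := lb a y; rewrite ger0_norm.
  exists (fun=> \int[power P n]_D @rademacher_average _ _ _ g n D).
  split; first by right.
  by move=> _; exact: (mean_rademacher_average_le P ml lb l_lip n0 mHk Hkh hdense).
have imp D : exists r, (forall x, `|fhat D x - hhat D x| <= r) /\
    ((beta * r)%:E <= beta%:E * eps_imp Hk Phi)%E.
  by apply: sup_norm_imp => //; [exact: HkL|apply/HimpL/PhiI].
have mfhat D r := mean_loss_dist P ml lb l_lip (r := r) (mHk _ (Hkf D)) (mhat D).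
(* The embedded hypothesis may lie outside the class, so the deviation is taken at [fhat D]; passing
   over in the risk and in the empirical risk costs [beta * r] each. *)
have gapP D : sup_deviation P g D <= 2 * W D + t -> gap_bound D.
  move=> UW; have [r [fr reps]] := imp D.
  have dev : mean_loss P l (fhat D) - emp_loss l D (fhat D) <=
      sup_deviation P g D.
    exact: (mean_emp_le P ml lb l_lip n0 mHk Hkh hdense D (Hkf D)).
  have key : mean_loss P l (hhat D) - emp_loss l D (hhat D) <=
      2 * (beta * r) + 2 * W D + t.
    have /ler_normlP[] := mfhat D r fr.
    by have /ler_normlP[] := emp_loss_dist l_lip D n0 fr; lra.
  have : ((2 * (beta * r) + 2 * W D + t)%:E <= (2 * beta)%:E * eps_imp Hk Phi +
      (2 * beta)%:E * Rad D + t%:E)%E.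
    rewrite !EFinD !(EFinM 2) -!muleA leeD2r//.
    by apply: leeD; apply: lee_wpmul2l => //; rewrite lee_fin.
  by apply: le_trans; rewrite (riskE P ml lb (mhat D)) -EFinB lee_fin.
have inf_Hk : inf_risk P l Hk \is a fin_num by exact: inf_risk_fin_num.
have inf_C : inf_risk P l Concept \is a fin_num by exact: inf_risk_fin_num.
have excP D : sup_deviation P g D + sup_deviation P (fun j z => - g j z) D <=
    4 * W D + t -> excess_bound D.
  move=> UVW; have [r [fr reps]] := imp D.
  set i := fine (inf_risk P l Hk); set k0 := fine (inf_risk P l Concept).
  (* A lower bound for the risk of every competitor, hence for the infimum. The embedding then
     enters only through the risk, at the price of a single [beta * r]. *)
  have opt : mean_loss P l (fhat D) - (4 * W D + t) <= i.
    rewrite -lee_fin /i fineK//; apply: le_ereal_inf_tmp => _ [f Hf <-].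
    rewrite (riskE P ml lb (mHk _ Hf)) lee_fin.
    have dev : mean_loss P l (fhat D) - emp_loss l D (fhat D) <=
        sup_deviation P g D.
      exact: (mean_emp_le P ml lb l_lip n0 mHk Hkh hdense D (Hkf D)).
    have devN : emp_loss l D f - mean_loss P l f <=
        sup_deviation P (fun j z => - g j z) D.
      exact: (emp_mean_le P ml lb l_lip n0 mHk Hkh hdense D Hf).
    have ermf : emp_loss l D (fhat D) <= emp_loss l D f.
      by rewrite -lee_fin; exact: (erm D).2.
    by lra.
  have key : mean_loss P l (hhat D) - k0 <= beta * r + (i - k0) + 4 * W D + t.
    by have /ler_normlP[] := mfhat D r fr; lra.
  have : ((beta * r + (i - k0) + 4 * W D + t)%:E <= beta%:E * eps_imp Hk Phi +
      eps_model P l Hk Concept + (4 * beta)%:E * Rad D + t%:E)%E.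
    rewrite !EFinD EFinN /i /k0 !fineK// !(EFinM 4) -!muleA leeD2r//.
    apply: leeD; first exact: leeD2r.
    by apply: lee_wpmul2l => //; rewrite lee_fin.
  apply: le_trans; rewrite (riskE P ml lb (mhat D)) -(fineK inf_C).
  by rewrite -EFinB lee_fin.
have prob L : 0 <= L -> 18 * c * Num.sqrt (n%:R * L) <= t ->
    holds_with_probability (power P n) (1 - expR (- L)) excess_bound /\
    holds_with_probability (power P n) (1 - expR (- L)) gap_bound.
  move=> L0 Lt; split.
    have := uniform_deviation2 bg c0 gc n0 L0 WE; apply: holds_with_probabilityW => //.
    by move=> D /= h1; apply: excP; rewrite (le_trans h1)// lerD2l.
  have := uniform_deviation bg c0 gc n0 L0 WE; apply: holds_with_probabilityW => //.
  by move=> D /= h1; apply: gapP; rewrite (le_trans h1)// lerD2l.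
pose L := ln (1 / delta).
have L0 : 0 <= L by rewrite ln_ge0// div1r invf_ge1// ltW.
have expL : expR (- L) = delta by rewrite /L div1r lnV// opprK lnK.
have sqrtE : n%:R^-1 * Num.sqrt (n%:R * L) = Num.sqrt (L / n%:R).
  rewrite -[LHS]ger0_norm ?mulr_ge0 ?invr_ge0 ?sqrtr_ge0//.
  rewrite -sqrtr_sqr exprMn sqr_sqrtr ?mulr_ge0//; congr Num.sqrt.
  by field; rewrite pnatr_eq0 -lt0n.
have tE : t = 36 * c * Num.sqrt (n%:R * L).
  by rewrite /t -/L -sqrtE /c; ring.
have s0 : 0 <= c * Num.sqrt (n%:R * L) by rewrite mulr_ge0 ?sqrtr_ge0.
have [|exc gap] := prob L L0; first by rewrite tE; lra.
rewrite expL in exc gap; split=> // delta_le.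
(* Each event now fails with probability at most delta^2, and 2 delta^2 <= delta because delta is at
   most 1/2. *)
have [||exc2 gap2] := prob (2 * L).
- exact: mulr_ge0.
- have : Num.sqrt (n%:R * (2 * L)) <= 2 * Num.sqrt (n%:R * L).
    have two : 2 = Num.sqrt (2 ^+ 2) :> R by rewrite sqrtr_sqr ger0_norm.
    rewrite [X in _ <= X * _]two -sqrtrM ?sqr_ge0//.
    rewrite ler_wsqrtr// expr2 -mulrA [leLHS]mulrCA ler_pM2l//.
    by have := mulr_ge0 (ler0n R n) L0; lra.
  by move/(ler_wpM2l c0); rewrite tE; lra.
have := holds_with_probabilityI exc2 gap2; apply: holds_with_probabilityW => //.
have -> : - (2 * L) = - L + - L by ring.
rewrite expRD expL; have : 0 <= delta * (1 - 2 * delta).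
  by apply: mulr_ge0; lra.
by rewrite mulrBr; lra.
Qed.
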